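(* Let $b>0$, let $q:[0,b]\to\mathbb{C}$ be continuous, let $f$ be a non-vanishing complex-valued solution of $f''-qf=0$ on $[0,b]$ with $f(0)=1$, and put $h:=f'(0)$. Let $K$ be the transmutation kernel and $\beta_j$ the functions defined in the context. Then $$K(x,t)=\sum_{j=0}^{\infty}\frac{\beta_j(x)}{x}\,P_j\!\left(\frac{t}{x}\right),$$ where for every $x\in(0,b]$ the series converges uniformly with respect to $t\in[-x,x]$.
   Context: $P_n$ denotes the Legendre polynomial of degree $n$. Transmutation kernel: $K$ is the (unique continuous) function on $\{(x,t):0\le x\le b,\ |t|\le x\}$ satisfying $$K(x,t)=\frac h2+\frac12\int_0^{\frac{x+t}{2}}q(s)\,ds+\int_0^{\frac{x+t}{2}}\int_0^{\frac{x-t}{2}}q(\alpha+\beta)K(\alpha+\beta,\alpha-\beta)\,d\beta\,d\alpha .$$ It is the $C^1$ kernel of the transmutation operator $Tu(x)=u(x)+\int_{-x}^{x}K(x,t)u(t)\,dt$, which satisfies $\left(-\frac{d^2}{dx^2}+q\right)T[u]=T[-u'']$ for $u\in C^2$ and $T[1]=f$. Formal powers: $X^{(0)}\equiv\widetilde X^{(0)}\equiv1$ and, for $n\ge1$, $$X^{(n)}(x)=n\int_0^xX^{(n-1)}(s)\,(f^2(s))^{(-1)^n}ds,\qquad \widetilde X^{(n)}(x)=n\int_0^x\widetilde X^{(n-1)}(s)\,(f^2(s))^{(-1)^{n-1}}ds;$$ $\varphi_k=fX^{(k)}$ for odd $k$ and $\varphi_k=f\widetilde X^{(k)}$ for even $k$.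 Coefficients: let $p_{j,k}:=\int_{-1}^1P_j(y)y^k\,dy$. For $x\in(0,b]$ define recursively $$\beta_0(x)=\frac{f(x)-1}{2},\qquad \beta_1(x)=\frac32\left(\frac{\varphi_1(x)}{x}-1\right),$$ and for $k\ge2$ $$\beta_k(x)=\frac1{p_{k,k}}\Bigl(\frac{\varphi_k(x)}{x^k}-1-\sum_{j}p_{j,k}\beta_j(x)\Bigr),$$ where the sum runs over all $j$ with $0\le j\le k-2$ having the same parity as $k$. *)

(* Defs.v *)
From Stdlib Require Import Reals Lra Lia Arith Bool.
From Coquelicot Require Import Coquelicot.

Open Scope R_scope.

(** Functions on [[0,b]] (or on the triangle below) are represented by total
    functions of which only the values on that set are used: continuity and
    derivatives are taken within the set, hence one-sided at the boundary. *)

Definition Icc (a b : R) : R -> Prop := fun x => a <= x <= b.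

Definition is_derive_on (D : R -> Prop) (g g' : R -> C) : Prop :=
  forall x, D x ->
    filterdiff (K := R_AbsRing) (U := R_NormedModule) (V := C_R_NormedModule)
      g (within D (locally x)) (fun d => scal d (g' x)).

Definition CInt (g : R -> C) (a b : R) : C :=
  RInt (V := C_R_CompleteNormedModule) g a b.

(** Bonnet's recurrence
    [(m+1) P_{m+1}(y) = (2m+1) y P_m(y) - m P_{m-1}(y)]. *)
Fixpoint legendre (n : nat) (y : R) : R :=
  match n with
  | O => 1
  | S m =>
      match m with
      | O => y
      | S l =>
          ((2 * INR m + 1) * y * legendre m y - INR m * legendre l y) / INR n
      end
  end.

Definition kernel_domain (b : R) : R * R -> Prop :=
  fun p => 0 <= fst p <= b /\ Rabs (snd p) <= fst p.

Definition is_transmutation_kernel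
    (b : R) (q : R -> C) (h : C) (K : R -> R -> C) : Prop :=
  continuous_on (T := prod_UniformSpace R_UniformSpace R_UniformSpace)
    (U := C_UniformSpace) (kernel_domain b) (fun p => K (fst p) (snd p)) /\
  forall x t, kernel_domain b (x, t) ->
    K x t =
      (h / 2 + / 2 * CInt q 0 ((x + t) / 2)
       + CInt (fun alpha =>
           CInt (fun beta => q (alpha + beta)%R * K (alpha + beta)%R (alpha - beta)%R)
             0 ((x - t) / 2))
           0 ((x + t) / 2))%C.

(** [Cpow_sign z n] is [z] to the power [(-1)^n]. *)
Definition Cpow_sign (z : C) (n : nat) : C :=
  if Nat.even n then z else (/ z)%C.

Fixpoint formal_power (f : R -> C) (n : nat) (x : R) : C :=
  match n with
  | O => 1%C
  | S m =>
      (INR n * CInt (fun s => formal_power f m s * Cpow_sign (f s ^ 2) n) 0 x)%C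
  end.

Fixpoint formal_power_tilde (f : R -> C) (n : nat) (x : R) : C :=
  match n with
  | O => 1%C
  | S m =>
      (INR n *
       CInt (fun s => formal_power_tilde f m s * Cpow_sign (f s ^ 2) m) 0 x)%C
  end.

Definition phi (f : R -> C) (k : nat) (x : R) : C :=
  (f x * (if Nat.odd k then formal_power f k x else formal_power_tilde f k x))%C.

Definition legendre_moment (j k : nat) : R :=
  RInt (fun y => legendre j y * y ^ k) (-1) 1.

(** The right-hand side of the definition of [beta_k(x)], where [prev j] stands
    for [beta_j(x)] with [j < k]. *)
Definition beta_step (f : R -> C) (x : R) (prev : nat -> C) (k : nat) : C :=
  match k with
  | O => ((f x - 1) / 2)%C
  | S O => (3 / 2 * (phi f 1 x / x - 1))%C
  | S (S m) =>
      (/ legendre_moment k k *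
       (phi f k x / x ^ k - 1
        - sum_n (fun j => if eqb (Nat.even j) (Nat.even k)
                          then (legendre_moment j k * prev j)%C else RtoC 0) m))%C
  end.

(** Course-of-values recursion: [beta_below f x n j] is [beta_j(x)] for [j < n],
    and [0] otherwise. *)
Fixpoint beta_below (f : R -> C) (x : R) (n : nat) : nat -> C :=
  match n with
  | O => fun _ => 0%C
  | S k => fun j =>
      if Nat.eqb j k then beta_step f x (beta_below f x k) k
      else beta_below f x k j
  end.

Definition beta (f : R -> C) (k : nat) (x : R) : C := beta_below f x (S k) k.

Lemma beta_below_eq f x n j : (j < n)%nat -> beta_below f x n j = beta f j x.
Proof.
induction n as [|n IH]; intros Hj; [lia|].
destruct (Nat.eq_dec j n) as [->|Hne]; [reflexivity|].
simpl. rewrite (proj2 (Nat.eqb_neq j n) Hne). apply IH; lia.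
Qed.

Lemma beta_0 f x : beta f 0 x = ((f x - 1) / 2)%C.
Proof. reflexivity. Qed.

Lemma beta_1 f x : beta f 1 x = (3 / 2 * (phi f 1 x / x - 1))%C.
Proof. reflexivity. Qed.

Lemma beta_rec f x k : (2 <= k)%nat ->
  beta f k x =
    (/ legendre_moment k k *
     (phi f k x / x ^ k - 1
      - sum_n (fun j => if eqb (Nat.even j) (Nat.even k)
                        then (legendre_moment j k * beta f j x)%C else RtoC 0) (k - 2)))%C.
Proof.
destruct k as [|[|m]]; intros Hk; try lia.
transitivity (beta_step f x (beta_below f x (S (S m))) (S (S m))).
  unfold beta; remember (S (S m)) as k; cbn [beta_below].
  now rewrite Nat.eqb_refl.
unfold beta_step; replace (S (S m) - 2)%nat with m by lia.
apply f_equal, f_equal, sum_n_ext_loc; intros j Hj.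
rewrite beta_below_eq by lia; reflexivity.
Qed.

(* Main.v *)
Require Import Defs.
From Stdlib Require Import Reals Lra Lia Arith IndefiniteDescription.
From Coquelicot Require Import Coquelicot.

(** The numbers [beta f k x / x] are the Fourier-Legendre coefficients of the
    function [g y = K x (x * y)] on [[-1,1]], and the Legendre series of a
    continuously differentiable function converges uniformly.

    _Identification of the coefficients._ Expanding [y ^ k] in Legendre
    polynomials shows that the coefficients of [g] solve the triangular system
    that defines [beta], with [x] times the integral of [g y * y ^ k] in place of
    [phi f k x / x ^ k - 1] ([beta_legendre_coef]). Both sides agree by the
    transmutation identity: [phi f k x] equals [x ^ k] plus the integral of
    [K x t * t ^ k] over [[-x,x]] ([transmuted_phi]). The potential [q] is only
    continuous, so [K] need not have second derivatives, but its moments do.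
    Write [M p x] for the integral of [K x t * p t] over [[-x,x]]. The
    substitution [t = x - w] makes the lines [x - t = w], along which the integral
    equation can be differentiated in [x], independent of [x], and after one
    derivative the substitution [t = w - x] does the same for the other family of
    characteristics ([is_derive_moment], [is_derive_density_moment]). The
    derivatives that fall on [p] add up to
    [(M p)'' = M (p'') + q * p + q * M p].
    Hence [v_k = x ^ k + M (t ^ k)] satisfies
    [v_k'' = q v_k + k (k - 1) v_(k-2)], and as [f'' = q f],
    [(f v_k' - f' v_k)' = k (k - 1) f v_(k-2)] and
    [(v_k / f)' = (f v_k' - f' v_k) / f ^ 2]. Integrating these two equations
    is exactly the passage from the formal power of order [k - 2] to that of
    order [k].

    _Uniform convergence._ Partial sums of order at least [m] reproduce
    polynomials of degree [m]. Approximating [g'] uniformly by polynomials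
    reduces the claim to a bound, uniform in the order [n], of the partial sums of
    a function [r] with [r (-1) = 0] by a multiple of the supremum of [|r'|]
    ([legendre_sum_bound]). Since [(2 j + 1) P_j = P_(j+1)' - P_(j-1)'],
    integration by parts and telescoping turn the partial sum of [r] into an
    integral of the partial sum of [r'] plus boundary terms
    ([legendre_sum_parts]). Bessel's inequality bounds the integral, and
    [|P_j| <= 1] the boundary terms. *)

Open Scope R_scope.

(** * Continuous real functions and their integrals *)

(** Equations produced by derivatives, sums and integrals are typed in the carrier
    of an algebraic structure; [ring] and [field] need the type [R] itself. *)
Ltac as_R_eq := match goal with |- ?a = ?b => change (@eq R a b) end.

Ltac R_ring := apply Rminus_diag_uniq; ring.

Definition cont (f : R -> R) : Prop := forall x, continuous f x.

Lemma ex_RInt_cont f a b : cont f -> ex_RInt f a b.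
Proof. intros Hf; apply (ex_RInt_continuous (V := R_CompleteNormedModule)); intros; apply Hf. Qed.

Lemma cont_const c : cont (fun _ => c).
Proof. intros x; apply continuous_const. Qed.

Lemma cont_id : cont (fun x => x).
Proof. intros x; apply continuous_id. Qed.

Lemma cont_plus f g : cont f -> cont g -> cont (fun x => f x + g x).
Proof. intros Hf Hg x; exact (continuous_plus f g x (Hf x) (Hg x)). Qed.

Lemma cont_minus f g : cont f -> cont g -> cont (fun x => f x - g x).
Proof. intros Hf Hg x; exact (continuous_minus f g x (Hf x) (Hg x)). Qed.

Lemma cont_mult f g : cont f -> cont g -> cont (fun x => f x * g x).
Proof. intros Hf Hg x; exact (continuous_mult f g x (Hf x) (Hg x)). Qed.

Lemma cont_comp f g : cont f -> cont g -> cont (fun x => g (f x)).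
Proof. intros Hf Hg x; exact (continuous_comp f g x (Hf x) (Hg (f x))). Qed.

Lemma cont_derive f f' : (forall x, is_derive f x (f' x)) -> cont f.
Proof.
intros Hf x; apply (ex_derive_continuous (K := R_AbsRing) (V := R_NormedModule)).
exists (f' x); apply Hf.
Qed.

Lemma cont_pow k : cont (fun x => x ^ k).
Proof.
induction k as [|k IH]; [exact (cont_const 1)|].
exact (cont_mult _ _ cont_id IH).
Qed.

Lemma RInt_plus_cont f g a b : cont f -> cont g ->
  RInt (fun x => f x + g x) a b = RInt f a b + RInt g a b.
Proof. intros Hf Hg; exact (RInt_plus f g a b (ex_RInt_cont f a b Hf) (ex_RInt_cont g a b Hg)). Qed.

Lemma RInt_minus_cont f g a b : cont f -> cont g ->
  RInt (fun x => f x - g x) a b = RInt f a b - RInt g a b.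
Proof. intros Hf Hg; exact (RInt_minus f g a b (ex_RInt_cont f a b Hf) (ex_RInt_cont g a b Hg)). Qed.

Lemma RInt_scal_cont c f a b : cont f ->
  RInt (fun x => c * f x) a b = c * RInt f a b.
Proof. intros Hf; exact (RInt_scal f a b c (ex_RInt_cont f a b Hf)). Qed.

Lemma RInt_ext_all (f g : R -> R) a b : (forall x, f x = g x) ->
  RInt f a b = RInt g a b.
Proof. intros H; apply RInt_ext; intros; apply H. Qed.

Lemma RInt_of_derive f f' a b : (forall x, is_derive f x (f' x)) -> cont f' ->
  RInt f' a b = f b - f a.
Proof.
intros Hf Hc; apply is_RInt_unique.
apply (is_RInt_derive f f'); intros; [apply Hf|apply Hc].
Qed.

Lemma cont_sum_n (F : nat -> R -> R) n : (forall j, cont (F j)) ->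
  cont (fun x => sum_n (fun j => F j x) n).
Proof.
intros HF; induction n as [|n IH]; intros x.
- apply (continuous_ext (F 0%nat)); [intros; now rewrite sum_O|apply HF].
- apply (continuous_ext (fun x => sum_n (fun j => F j x) n + F (S n) x)).
  + intros; now rewrite sum_Sn.
  + exact (cont_plus _ _ IH (HF _) x).
Qed.

Lemma sum_n_S (u : nat -> R) n : sum_n u (S n) = sum_n u n + u (S n).
Proof. exact (sum_Sn u n). Qed.

Lemma sum_n_scal (c : R) (u : nat -> R) n :
  sum_n (fun j => c * u j) n = c * sum_n u n.
Proof. exact (sum_n_mult_l (K := R_Ring) c u n). Qed.

Lemma RInt_sum_n (F : nat -> R -> R) n a b : (forall j, cont (F j)) ->
  RInt (fun x => sum_n (fun j => F j x) n) a b = sum_n (fun j => RInt (F j) a b) n.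
Proof.
intros HF; induction n as [|n IH].
- rewrite sum_O; apply RInt_ext_all; intros; now rewrite sum_O.
- rewrite sum_Sn, <- IH.
  rewrite (RInt_ext_all _ (fun x => sum_n (fun j => F j x) n + F (S n) x)).
  + apply RInt_plus_cont; [now apply cont_sum_n|apply HF].
  + intros; now rewrite sum_Sn.
Qed.

Lemma is_derive_eq (f : R -> R) (x d e : R) : is_derive f x d -> d = e -> is_derive f x e.
Proof. intros H <-; exact H. Qed.

(** * Legendre polynomials *)

Lemma legendre_bonnet n y :
  INR (n + 2) * legendre (S (S n)) y
  = (2 * INR n + 3) * y * legendre (S n) y - INR (S n) * legendre n y.
Proof.
cbn [legendre]. replace (n + 2)%nat with (S (S n)) by lia.
rewrite !S_INR. pose proof (pos_INR n). field. lra.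
Qed.

(** The derivative of [legendre n]. Together with [legendre'_down] its recurrence is
    one of the two contiguous relations from which the others follow. *)
Fixpoint legendre' (n : nat) (y : R) : R :=
  match n with
  | O => 0
  | S m => y * legendre' m y + INR n * legendre m y
  end.

(** Both contiguous relations at [n], the one in the definition of [legendre'] and
    this one, give this one at [n + 1] after eliminating [legendre (n + 2)] by
    Bonnet's recurrence. *)
Lemma legendre'_down n y :
  y * legendre' (S n) y - legendre' n y = INR (S n) * legendre (S n) y.
Proof.
induction n as [|n IH]; [simpl; ring|].
pose proof (legendre_bonnet n y) as B.
change (legendre' (S (S n)) y)
  with (y * legendre' (S n) y + INR (S (S n)) * legendre (S n) y).
assert (E : legendre' (S n) y = y * legendre' n y + INR (S n) * legendre n y) by reflexivity.
replace (n + 2)%nat with (S (S n)) in B by lia.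
rewrite B, !S_INR in *.
assert (E2 : y * (y * legendre' (S n) y) = y * (legendre' n y + (INR n + 1) * legendre (S n) y))
  by (f_equal; lra).
nra.
Qed.

Lemma is_derive_legendre n y : is_derive (legendre n) y (legendre' n y).
Proof.
cut (is_derive (legendre n) y (legendre' n y) /\
     is_derive (legendre (S n)) y (legendre' (S n) y)); [tauto|].
induction n as [|n [IH1 IH2]].
- split; simpl.
  + apply (is_derive_const (K := R_AbsRing) (V := R_NormedModule)).
  + replace (y * 0 + 1 * 1) with 1 by ring.
    apply (is_derive_id (K := R_AbsRing)).
- split; [exact IH2|].
  pose proof (legendre'_down n y) as D. pose proof (pos_INR n) as Hn.
  apply (is_derive_ext (fun z => / INR (S (S n)) *
    ((2 * INR (S n) + 1) * (z * legendre (S n) z) - INR (S n) * legendre n z))).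
  { intros t. change (legendre (S (S n)) t) with
     (((2 * INR (S n) + 1) * t * legendre (S n) t - INR (S n) * legendre n t) / INR (S (S n))).
    as_R_eq. rewrite !S_INR. field. lra. }
  eapply is_derive_eq.
  { apply is_derive_scal. apply (is_derive_minus (K := R_AbsRing) (V := R_NormedModule)).
    - apply is_derive_scal. apply (is_derive_mult (K := R_AbsRing)).
      + apply (is_derive_id (K := R_AbsRing)).
      + exact IH2.
      + intros; apply Rmult_comm.
    - apply is_derive_scal; exact IH1. }
  change (legendre' (S (S n)) y)
  with (y * legendre' (S n) y + INR (S (S n)) * legendre (S n) y).
  unfold minus, plus, opp, mult, one; cbn -[INR legendre legendre'].
  replace (legendre' n y) with (y * legendre' (S n) y - INR (S n) * legendre (S n) y) by lra.
  rewrite !S_INR. unfold mult, one; cbn -[INR legendre legendre']. field. lra.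
Qed.

Lemma cont_legendre n : cont (legendre n).
Proof. apply (cont_derive _ (legendre' n)); intros; apply is_derive_legendre. Qed.

(** What makes antiderivatives of Legendre polynomials explicit, hence also the
    integration by parts in Legendre coefficients. *)
Lemma legendre'_diff n y :
  legendre' (S (S n)) y - legendre' n y = (2 * INR n + 3) * legendre (S n) y.
Proof.
pose proof (legendre'_down n y) as D.
change (legendre' (S (S n)) y)
  with (y * legendre' (S n) y + INR (S (S n)) * legendre (S n) y).
rewrite !S_INR in *. lra.
Qed.

Lemma legendre'_closed n y :
  (1 - y ^ 2) * legendre' (S n) y = INR (S n) * (legendre n y - y * legendre (S n) y).
Proof.
pose proof (legendre'_down n y) as D.
assert (E : legendre' (S n) y = y * legendre' n y + INR (S n) * legendre n y) by reflexivity.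
assert (E2 : y * (y * legendre' (S n) y - legendre' n y) = y * (INR (S n) * legendre (S n) y))
  by (now rewrite D).
lra.
Qed.

Lemma legendre_at_1 n : legendre n 1 = 1.
Proof.
cut (legendre n 1 = 1 /\ legendre (S n) 1 = 1); [tauto|].
induction n as [|n [I1 I2]]; [simpl; lra|split; [exact I2|]].
pose proof (legendre_bonnet n 1) as B. rewrite I1, I2 in B.
replace (n + 2)%nat with (S (S n)) in B by lia. rewrite !S_INR in B.
pose proof (pos_INR n). apply (Rmult_eq_reg_l (INR n + 1 + 1)); lra.
Qed.

Lemma legendre_parity n y : legendre n (- y) = (-1) ^ n * legendre n y.
Proof.
cut (legendre n (- y) = (-1) ^ n * legendre n y /\
     legendre (S n) (- y) = (-1) ^ S n * legendre (S n) y); [tauto|].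
induction n as [|n [I1 I2]]; [simpl; lra|split; [exact I2|]].
pose proof (legendre_bonnet n (- y)) as B. rewrite I1, I2 in B.
pose proof (legendre_bonnet n y) as B2.
replace (n + 2)%nat with (S (S n)) in * by lia. rewrite !S_INR in *.
pose proof (pos_INR n). apply (Rmult_eq_reg_l (INR n + 1 + 1)); [|lra].
rewrite B. simpl pow in *.
replace ((INR n + 1 + 1) * (-1 * (-1 * (-1) ^ n) * legendre (S (S n)) y))
  with ((-1) ^ n * ((INR n + 1 + 1) * legendre (S (S n)) y)) by ring.
rewrite B2; ring.
Qed.

Lemma legendre_at_m1 n : legendre n (-1) = (-1) ^ n.
Proof. replace (-1) with (- (1)) at 1 by ring. rewrite legendre_parity, legendre_at_1. ring. Qed.

Lemma RInt_legendre n y :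
  RInt (legendre (S n)) (-1) y
  = / (2 * INR n + 3) * (legendre (S (S n)) y - legendre n y).
Proof.
pose proof (pos_INR n).
rewrite (RInt_ext_all _ (fun z => / (2 * INR n + 3) * (legendre' (S (S n)) z - legendre' n z))).
2:{ intros; rewrite legendre'_diff. field; lra. }
assert (D : forall x, is_derive (fun z => / (2 * INR n + 3) * (legendre (S (S n)) z - legendre n z)) x
   (/ (2 * INR n + 3) * (legendre' (S (S n)) x - legendre' n x))).
{ intros x. apply is_derive_scal.
  apply (is_derive_minus (K := R_AbsRing) (V := R_NormedModule)); apply is_derive_legendre. }
refine (eq_trans (RInt_of_derive _ _ (-1) y D _) _).
2: as_R_eq; rewrite !legendre_at_m1; cbn [pow]; field; lra.
- intros x. apply (continuous_ext (legendre (S n))).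
  + intros t. as_R_eq. rewrite legendre'_diff. field; lra.
  + apply cont_legendre.
Qed.

Lemma RInt_legendre_0 y : RInt (legendre 0) (-1) y = y + 1.
Proof.
rewrite (RInt_ext_all _ (fun _ => 1)) by reflexivity.
rewrite RInt_const; unfold scal; simpl; unfold mult; simpl. ring.
Qed.

(** * Orthogonality of the Legendre polynomials *)

Definition inner (u v : R -> R) : R := RInt (fun y => u y * v y) (-1) 1.

Lemma inner_sym u v : inner u v = inner v u.
Proof. apply RInt_ext_all; intros; ring. Qed.

Lemma inner_plus u v w : cont u -> cont v -> cont w ->
  inner (fun y => u y + v y) w = inner u w + inner v w.
Proof.
intros Hu Hv Hw. unfold inner. rewrite <- RInt_plus_cont by now apply cont_mult.
apply RInt_ext_all; intros; ring.
Qed.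

Lemma inner_minus u v w : cont u -> cont v -> cont w ->
  inner (fun y => u y - v y) w = inner u w - inner v w.
Proof.
intros Hu Hv Hw. unfold inner. rewrite <- RInt_minus_cont by now apply cont_mult.
apply RInt_ext_all; intros; ring.
Qed.

Lemma inner_scal c u w : cont u -> cont w -> inner (fun y => c * u y) w = c * inner u w.
Proof.
intros Hu Hw. unfold inner. rewrite <- RInt_scal_cont by now apply cont_mult.
apply RInt_ext_all; intros; ring.
Qed.

Lemma inner_sum_n (F : nat -> R -> R) n w : (forall j, cont (F j)) -> cont w ->
  inner (fun y => sum_n (fun j => F j y) n) w = sum_n (fun j => inner (F j) w) n.
Proof.
intros HF Hw. unfold inner. rewrite <- RInt_sum_n.
- apply RInt_ext_all; intros x. rewrite Rmult_comm, <- sum_n_scal.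
  apply sum_n_ext; intros; apply Rmult_comm.
- intros j; now apply cont_mult.
Qed.

Lemma inner_ext u v w : (forall y, -1 < y < 1 -> u y = v y) -> inner u w = inner v w.
Proof.
intros H; apply RInt_ext; intros x Hx. rewrite Rmin_left, Rmax_right in Hx by lra.
now rewrite H.
Qed.

(** Bonnet's recurrence as multiplication by [y]. The coefficient of
    [legendre (pred n)] vanishes at [n = 0], so that no case distinction is needed. *)
Lemma mul_legendre n y :
  y * legendre n y
  = INR (S n) / (2 * INR n + 1) * legendre (S n) y
    + INR n / (2 * INR n + 1) * legendre (pred n) y.
Proof.
destruct n as [|n]; [simpl; field|].
pose proof (legendre_bonnet n y) as B. pose proof (pos_INR n).
replace (n + 2)%nat with (S (S n)) in B by lia.
cbn [pred]. apply (Rmult_eq_reg_l (2 * INR (S n) + 1)).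
- transitivity (INR (S (S n)) * legendre (S (S n)) y + INR (S n) * legendre n y).
  + rewrite B, !S_INR. ring.
  + rewrite !S_INR. field. lra.
- rewrite S_INR; lra.
Qed.

Lemma inner_mul_legendre n u : cont u ->
  inner (fun y => y * u y) (legendre n)
  = INR (S n) / (2 * INR n + 1) * inner u (legendre (S n))
    + INR n / (2 * INR n + 1) * inner u (legendre (pred n)).
Proof.
intros Hu. rewrite !(inner_sym u), <- !inner_scal by (try apply cont_legendre; auto).
rewrite <- inner_plus; try (apply cont_mult; [apply cont_const|apply cont_legendre]); auto.
apply RInt_ext_all; intros y.
rewrite <- mul_legendre. ring.
Qed.

(** Multiplication by [y] is symmetric for [inner]. Moving it from [legendre m] to
    [legendre n] lowers the smaller index at the expense of the larger one, down to
    [legendre 0], where [RInt_legendre] and [legendre_at_1] give the value. *)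
Lemma legendre_orth m n : (m < n)%nat -> inner (legendre m) (legendre n) = 0.
Proof.
revert n; induction m as [m IH] using lt_wf_ind; intros n Hmn.
destruct m as [|m].
- destruct n as [|n]; [lia|]. unfold inner.
  rewrite (RInt_ext_all _ (legendre (S n))) by (intros; simpl legendre at 1; ring).
  rewrite RInt_legendre, !legendre_at_1. ring.
- pose proof (pos_INR m).
  assert (H0 : inner (fun y => y * legendre m y) (legendre n) = 0).
  { rewrite inner_mul_legendre by apply cont_legendre.
    rewrite !(IH m) by lia. ring. }
  assert (H1 : inner (fun y => y * legendre m y) (legendre n) =
     INR (S m) / (2 * INR m + 1) * inner (legendre (S m)) (legendre n)
     + INR m / (2 * INR m + 1) * inner (legendre (pred m)) (legendre n)).
  { rewrite <- !inner_scal by apply cont_legendre.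
    rewrite <- inner_plus; try (apply cont_mult; [apply cont_const|apply cont_legendre]);
      try apply cont_legendre.
    apply RInt_ext_all; intros y. now rewrite <- mul_legendre. }
  rewrite H0 in H1.
  rewrite (IH (pred m)) in H1 by lia.
  assert (0 < INR (S m) / (2 * INR m + 1)).
  { rewrite S_INR; apply Rdiv_lt_0_compat; lra. }
  nra.
Qed.

(** The same symmetry compares the norms of consecutive polynomials. *)
Lemma legendre_norm n : inner (legendre n) (legendre n) = 2 / (2 * INR n + 1).
Proof.
induction n as [|n IH].
- unfold inner. rewrite (RInt_ext_all _ (legendre 0)) by (intros; simpl; ring).
  rewrite RInt_legendre_0; simpl; field.
- pose proof (pos_INR n).
  pose proof (inner_mul_legendre n (legendre (S n)) (cont_legendre _)) as A.
  pose proof (inner_mul_legendre (S n) (legendre n) (cont_legendre _)) as B.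
  rewrite (inner_sym (legendre (S n)) (legendre (pred n))), (legendre_orth (pred n)) in A by lia.
  rewrite (legendre_orth n (S (S n))) in B by lia.
  cbn [pred] in B. rewrite IH in B.
  replace (inner (fun y => y * legendre (S n) y) (legendre n))
    with (inner (fun y => y * legendre n y) (legendre (S n))) in A
    by (apply RInt_ext_all; intros; ring).
  rewrite B in A. rewrite !S_INR in *.
  apply (Rmult_eq_reg_l ((INR n + 1) / (2 * INR n + 1))).
  + match type of A with _ = ?r => transitivity r; [ring|] end.
    rewrite <- A. field. lra.
  + apply Rgt_not_eq, Rdiv_lt_0_compat; lra.
Qed.

Lemma ex_derive_legendre' n y : ex_derive (legendre' n) y.
Proof.
induction n as [|n IH].
- apply (ex_derive_const (K := R_AbsRing) (V := R_NormedModule)).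
- apply (ex_derive_plus (K := R_AbsRing) (V := R_NormedModule)).
  + apply (ex_derive_mult (fun y => y)); [apply ex_derive_id|exact IH].
  + apply (ex_derive_scal (fun y => legendre n y)). exists (legendre' n y); apply is_derive_legendre.
Qed.

(** Legendre's equation, obtained by differentiating [legendre'_closed]. *)
Lemma legendre_ode n y :
  (1 - y ^ 2) * Derive (legendre' n) y
  = 2 * y * legendre' n y - INR n * INR (S n) * legendre n y.
Proof.
destruct n as [|n].
{ rewrite (Derive_ext _ (fun _ => 0)) by reflexivity. rewrite Derive_const. simpl; ring. }
assert (L : is_derive (fun y => (1 - y ^ 2) * legendre' (S n) y) y
   (- 2 * y * legendre' (S n) y + (1 - y ^ 2) * Derive (legendre' (S n)) y)).
{ generalize (ex_derive_legendre' (S n) y). generalize (legendre' (S n)); intros u Hu.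
  auto_derive; [now repeat split|].
  change (Derive (fun x => u x) y) with (Derive u y). ring. }
assert (M : is_derive (fun y => (1 - y ^ 2) * legendre' (S n) y) y
   (INR (S n) * (legendre' n y - (legendre (S n) y + y * legendre' (S n) y)))).
{ apply (is_derive_ext (fun y => INR (S n) * (legendre n y - y * legendre (S n) y))).
  - intros t; as_R_eq; now rewrite legendre'_closed.
  - apply is_derive_scal.
    apply (is_derive_minus (K := R_AbsRing) (V := R_NormedModule)); [apply is_derive_legendre|].
    eapply is_derive_eq.
    + apply (is_derive_mult (K := R_AbsRing) (fun y => y)).
      * apply (is_derive_id (K := R_AbsRing)).
      * apply is_derive_legendre.
      * intros; apply Rmult_comm.
    + unfold plus, mult, one; cbn -[legendre legendre']. as_R_eq. ring. }
pose proof (is_derive_unique _ _ _ L) as E1. rewrite (is_derive_unique _ _ _ M) in E1.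
pose proof (legendre'_down n y) as D. rewrite !S_INR in *.
replace (legendre' n y) with (y * legendre' (S n) y - (INR n + 1) * legendre (S n) y) in E1 by lra.
lra.
Qed.

(** Sonin's argument: by Legendre's equation, the sum of [legendre n y ^ 2] and of
    [(1 - y ^ 2) * legendre' n y ^ 2 / (n * (n + 1))] has derivative
    [2 * y * legendre' n y ^ 2 / (n * (n + 1))], so on [[0,1]] it is at most its
    value [1] at [1]. Parity covers the negative [y]. *)
Lemma legendre_bound n y : -1 <= y <= 1 -> Rabs (legendre n y) <= 1.
Proof.
intros Hy.
destruct n as [|n]; [simpl; rewrite Rabs_R1; lra|].
cut (forall y, 0 <= y <= 1 -> Rabs (legendre (S n) y) <= 1).
{ intros H. destruct (Rle_dec 0 y); [apply H; lra|].
  replace y with (- - y) by ring. rewrite legendre_parity, Rabs_mult, pow_1_abs, Rmult_1_l.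
  apply H; lra. }
clear y Hy; intros y Hy.
set (k := INR (S n) * INR (S (S n))).
assert (Hk : 0 < k).
{ unfold k; rewrite !S_INR; pose proof (pos_INR n); nra. }
set (F := fun z => legendre (S n) z ^ 2 + (1 - z ^ 2) * legendre' (S n) z ^ 2 / k).
assert (DF : forall z, is_derive F z (2 * z * legendre' (S n) z ^ 2 / k)).
{ intros z. unfold F.
  pose proof (legendre_ode (S n) z) as O. fold k in O.
  generalize (ex_derive_legendre' (S n) z) (is_derive_legendre (S n) z).
  revert O; generalize (legendre (S n)) (legendre' (S n)); intros u v O Hv Hu.
  auto_derive; [repeat split; [now exists (v z)|exact Hv]|].
  change (Derive (fun x => v x) z) with (Derive v z).
  change (Derive (fun x => u x) z) with (Derive u z).
  rewrite (is_derive_unique _ _ _ Hu).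
  apply (Rmult_eq_reg_l k); [|lra].
  transitivity (2 * k * u z * v z - 2 * z * v z ^ 2
    + 2 * v z * ((1 - z ^ 2) * Derive v z)).
  - field. lra.
  - rewrite O. field. lra. }
destruct (MVT_gen F y 1 (fun z => 2 * z * legendre' (S n) z ^ 2 / k)) as [c [Hc E]].
- intros; apply DF.
- intros z _. apply continuity_pt_filterlim. apply (cont_derive _ _ DF).
- rewrite Rmin_left, Rmax_right in Hc by lra.
  assert (0 <= 2 * c * legendre' (S n) c ^ 2 / k * (1 - y)).
  { apply Rmult_le_pos; [|lra]. apply Rdiv_le_0_compat; [|lra].
    apply Rmult_le_pos; [lra|apply pow2_ge_0]. }
  assert (F 1 = 1).
  { unfold F. rewrite legendre_at_1. field. lra. }
  assert (0 <= (1 - y ^ 2) * legendre' (S n) y ^ 2 / k).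
  { apply Rdiv_le_0_compat; [|lra]. apply Rmult_le_pos; [nra|apply pow2_ge_0]. }
  unfold F in *.
  rewrite <- (Rabs_R1). apply Rsqr_le_abs_0. unfold Rsqr. nra.
Qed.

(** * Legendre sums *)

Definition legendre_coef (g : R -> R) (j : nat) : R :=
  (2 * INR j + 1) / 2 * inner g (legendre j).

Definition legendre_sum (g : R -> R) (n : nat) (y : R) : R :=
  sum_n (fun j => legendre_coef g j * legendre j y) n.

(** The polynomial functions of degree at most [n]. *)
Definition in_span (n : nat) (u : R -> R) : Prop :=
  exists c : nat -> R, forall y, u y = sum_n (fun j => c j * legendre j y) n.

Lemma sum_n_zero (F : nat -> R) n : (forall i, (i <= n)%nat -> F i = 0) -> sum_n F n = 0.
Proof.
induction n as [|n IH]; intros H.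
- rewrite sum_O; apply H; lia.
- rewrite sum_n_S, IH, H by (intros; try apply H; lia).
  R_ring.
Qed.

Lemma sum_n_single (F : nat -> R) n j : (j <= n)%nat ->
  (forall i, (i <= n)%nat -> i <> j -> F i = 0) -> sum_n F n = F j.
Proof.
induction n as [|n IH]; intros Hj H.
- rewrite sum_O; f_equal; lia.
- rewrite sum_n_S. destruct (Nat.eq_dec j (S n)) as [->|Hne].
  + rewrite sum_n_zero by (intros; apply H; lia). R_ring.
  + rewrite IH, (H (S n)) by (intros; try apply H; lia). R_ring.
Qed.

Lemma cont_legendre_comb (c : nat -> R) n :
  cont (fun y => sum_n (fun j => c j * legendre j y) n).
Proof.
apply (cont_sum_n (fun j y => c j * legendre j y)); intros j.
apply cont_mult; [apply cont_const|apply cont_legendre].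
Qed.

Lemma cont_legendre_sum g n : cont (legendre_sum g n).
Proof. apply cont_legendre_comb. Qed.

Lemma cont_in_span n u : in_span n u -> cont u.
Proof.
intros [c Hc] x. apply (continuous_ext (fun y => sum_n (fun j => c j * legendre j y) n)).
- intros; now rewrite Hc.
- apply cont_legendre_comb.
Qed.

Lemma in_span_mono n m u : (n <= m)%nat -> in_span n u -> in_span m u.
Proof.
intros Hnm [c Hc]. exists (fun j => if Nat.leb j n then c j else 0). intros y. rewrite Hc.
induction Hnm as [|m Hnm IH].
- apply sum_n_ext_loc; intros j Hj. now rewrite (proj2 (Nat.leb_le j n)) by lia.
- rewrite sum_n_S, <- IH, (proj2 (Nat.leb_gt (S m) n)) by lia.
  R_ring.
Qed.

Lemma in_span_ext n u v : (forall y, u y = v y) -> in_span n u -> in_span n v.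
Proof. intros H [c Hc]; exists c; intros; now rewrite <- H. Qed.

Lemma in_span_plus n u v : in_span n u -> in_span n v -> in_span n (fun y => u y + v y).
Proof.
intros [c Hc] [d Hd]. exists (fun j => c j + d j). intros y.
rewrite Hc, Hd. symmetry. rewrite (sum_n_ext _ (fun j => plus (c j * legendre j y) (d j * legendre j y))).
- apply (sum_n_plus (G := R_AbelianMonoid)).
- intros; unfold plus; simpl; R_ring.
Qed.

Lemma in_span_scal n a u : in_span n u -> in_span n (fun y => a * u y).
Proof.
intros [c Hc]. exists (fun j => a * c j). intros y.
rewrite Hc, <- sum_n_scal. apply sum_n_ext; intros; R_ring.
Qed.

Lemma in_span_legendre n j : (j <= n)%nat -> in_span n (legendre j).
Proof.
intros Hj. exists (fun i => if Nat.eqb i j then 1 else 0). intros y.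
rewrite (sum_n_single _ n j Hj).
- rewrite Nat.eqb_refl; ring.
- intros i _ Hi. rewrite (proj2 (Nat.eqb_neq i j) Hi). ring.
Qed.

Lemma in_span_const n a : in_span n (fun _ => a).
Proof.
apply (in_span_ext n (fun y => a * legendre 0 y)); [intros; simpl; ring|].
apply in_span_scal, in_span_legendre; lia.
Qed.

Lemma in_span_sum m (F : nat -> R -> R) n : (forall j, (j <= n)%nat -> in_span m (F j)) ->
  in_span m (fun y => sum_n (fun j => F j y) n).
Proof.
induction n as [|n IH]; intros H.
- apply (in_span_ext m (F 0%nat)); [intros; now rewrite sum_O|apply H; lia].
- apply (in_span_ext m (fun y => sum_n (fun j => F j y) n + F (S n) y)).
  + intros; now rewrite sum_n_S.
  + apply in_span_plus; [apply IH; intros|]; apply H; lia.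
Qed.

Lemma in_span_mul n u : in_span n u -> in_span (S n) (fun y => y * u y).
Proof.
intros [c Hc].
apply (in_span_ext _ (fun y => sum_n (fun j => c j * (y * legendre j y)) n)).
- intros y. rewrite Hc, <- sum_n_scal. apply sum_n_ext; intros; R_ring.
- apply in_span_sum; intros j Hj. apply in_span_scal.
  apply (in_span_ext _ (fun y => INR (S j) / (2 * INR j + 1) * legendre (S j) y
    + INR j / (2 * INR j + 1) * legendre (pred j) y)).
  + intros; now rewrite <- mul_legendre.
  + apply in_span_plus; apply in_span_scal, in_span_legendre; lia.
Qed.

Lemma in_span_pow k : in_span k (fun y => y ^ k).
Proof.
induction k as [|k IH]; [apply (in_span_const 0 1)|].
exact (in_span_mul k _ IH).
Qed.

Lemma in_span_RInt n u : in_span n u -> in_span (S n) (fun y => RInt u (-1) y).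
Proof.
intros [c Hc].
apply (in_span_ext _ (fun y => sum_n (fun j => c j * RInt (legendre j) (-1) y) n)).
- intros y.
  rewrite (RInt_ext_all u _ (-1) y Hc).
  rewrite (RInt_sum_n (fun j y => c j * legendre j y)).
  + apply sum_n_ext; intros j. as_R_eq. symmetry. apply RInt_scal_cont, cont_legendre.
  + intros j; apply cont_mult; [apply cont_const|apply cont_legendre].
- apply in_span_sum; intros [|j] Hj; apply in_span_scal.
  + apply (in_span_ext _ (fun y => legendre 1 y + legendre 0 y)).
    * intros; rewrite RInt_legendre_0; reflexivity.
    * apply in_span_plus; apply in_span_legendre; lia.
  + apply (in_span_ext _ (fun y => / (2 * INR j + 3) * (legendre (S (S j)) y + -1 * legendre j y))).
    * intros; rewrite RInt_legendre; ring.
    * apply in_span_scal, in_span_plus; [|apply in_span_scal]; apply in_span_legendre; lia.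
Qed.

Lemma inner_comb (c : nat -> R) n w : cont w ->
  inner (fun y => sum_n (fun j => c j * legendre j y) n) w
  = sum_n (fun j => c j * inner (legendre j) w) n.
Proof.
intros Hw. rewrite (inner_sum_n (fun j y => c j * legendre j y)).
- apply sum_n_ext; intros j; as_R_eq; apply inner_scal; [apply cont_legendre|exact Hw].
- intros j; apply cont_mult; [apply cont_const|apply cont_legendre].
- exact Hw.
Qed.

Lemma inner_comb_legendre (c : nat -> R) n j : (j <= n)%nat ->
  inner (fun y => sum_n (fun i => c i * legendre i y) n) (legendre j) = c j * (2 / (2 * INR j + 1)).
Proof.
intros Hj. rewrite inner_comb by apply cont_legendre.
rewrite (sum_n_single _ n j Hj).
- now rewrite legendre_norm.
- intros i _ Hi. destruct (Nat.lt_ge_cases i j).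
  + rewrite legendre_orth by lia; ring.
  + rewrite inner_sym, legendre_orth by lia; ring.
Qed.

Lemma legendre_sum_span n u m y : in_span n u -> (n <= m)%nat -> legendre_sum u m y = u y.
Proof.
intros Hu Hm. destruct (in_span_mono n m u Hm Hu) as [c Hc].
rewrite Hc. apply sum_n_ext_loc; intros j Hj. as_R_eq. f_equal.
unfold legendre_coef. rewrite (inner_ext u _ (legendre j) (fun y _ => Hc y)).
rewrite (inner_comb_legendre c m j Hj). pose proof (pos_INR j). field; lra.
Qed.

Lemma inner_legendre_sum g n j : (j <= n)%nat ->
  inner (legendre_sum g n) (legendre j) = inner g (legendre j).
Proof.
intros Hj. unfold legendre_sum. rewrite inner_comb_legendre by exact Hj.
unfold legendre_coef. pose proof (pos_INR j). field; lra.
Qed.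

(** The partial sum is the orthogonal projection of [g]: the norm of [g] exceeds
    that of its projection by the norm of the difference. *)
Lemma bessel g n : cont g -> inner (legendre_sum g n) (legendre_sum g n) <= inner g g.
Proof.
intros Hg. pose proof (cont_legendre_sum g n) as HS.
assert (E : inner (legendre_sum g n) (legendre_sum g n) = inner g (legendre_sum g n)).
{ rewrite (inner_sym g). unfold legendre_sum at 1 3. rewrite !inner_comb by assumption.
  apply sum_n_ext_loc; intros j Hj. as_R_eq. f_equal.
  rewrite !(inner_sym (legendre j)). now apply inner_legendre_sum. }
assert (P : 0 <= inner (fun y => g y - legendre_sum g n y) (fun y => g y - legendre_sum g n y)).
{ apply RInt_ge_0; [lra| |].
  - apply ex_RInt_cont; apply cont_mult; now apply cont_minus.
  - intros z Hz; apply Rle_0_sqr. }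
rewrite inner_minus in P by (try apply cont_minus; assumption).
rewrite (inner_sym g), (inner_sym (legendre_sum g n)), !inner_minus in P by assumption.
rewrite (inner_sym (legendre_sum g n) g) in P. lra.
Qed.

(** Partial sums of a continuous function need not be uniformly bounded, but their
    antiderivatives are, because Bessel's inequality bounds them in mean square. *)
Lemma RInt_legendre_sum_bound u n d y : cont u -> 0 < d ->
  (forall z, -1 <= z <= 1 -> Rabs (u z) <= d) -> -1 <= y <= 1 ->
  Rabs (RInt (legendre_sum u n) (-1) y) <= 2 * d.
Proof.
intros Hu Hd Hb Hy. set (S := legendre_sum u n).
assert (HS : cont S) by apply cont_legendre_sum.
(* By the arithmetic-geometric mean, the majorant W replaces the
   Cauchy-Schwarz inequality. *)
set (W := fun z => / (2 * d) * (S z * S z) + d / 2).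
assert (HW : cont W).
{ apply cont_plus; [|apply cont_const]. apply cont_mult; [apply cont_const|now apply cont_mult]. }
assert (SW : forall z, Rabs (S z) <= W z).
{ intros z. unfold W. apply (Rmult_le_reg_l (2 * d)); [lra|].
  replace (2 * d * (/ (2 * d) * (S z * S z) + d / 2)) with (S z * S z + d * d) by (field; lra).
  pose proof (pow2_ge_0 (Rabs (S z) - d)). pose proof (Rsqr_abs (S z)) as Q. unfold Rsqr in Q.
  nra. }
assert (W0 : forall z, 0 <= W z) by (intros; eapply Rle_trans; [apply Rabs_pos|apply SW]).
apply Rle_trans with (RInt W (-1) y).
{ eapply Rle_trans; [apply abs_RInt_le; [lra|now apply ex_RInt_cont]|].
  apply RInt_le; [lra| |now apply ex_RInt_cont|intros; apply SW].
  apply ex_RInt_cont.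
  intros z; apply (continuous_comp S Rabs); [apply HS|apply continuous_Rabs]. }
apply Rle_trans with (RInt W (-1) 1).
{ rewrite <- (RInt_Chasles W (-1) y 1) by now apply ex_RInt_cont.
  assert (0 <= RInt W y 1) by (apply RInt_ge_0; [lra|now apply ex_RInt_cont|intros; apply W0]).
  unfold plus; simpl; lra. }
unfold W. rewrite RInt_plus_cont, RInt_scal_cont;
 [|now apply cont_mult|apply cont_mult; [apply cont_const|now apply cont_mult]|apply cont_const].
rewrite RInt_const. unfold scal; simpl; unfold mult; simpl.
assert (B : RInt (fun x => S x * S x) (-1) 1 <= d * d * 2).
{ eapply Rle_trans; [exact (bessel u n Hu)|].
  eapply Rle_trans; [apply (RInt_le _ (fun _ => d * d)); [lra| | |]|].
  - apply ex_RInt_cont; now apply cont_mult.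
  - apply ex_RInt_cont, cont_const.
  - intros z Hz. pose proof (Hb z ltac:(lra)) as Q. apply Rabs_le_between in Q. nra.
  - rewrite RInt_const. unfold scal; simpl; unfold mult; simpl. lra. }
apply (Rmult_le_reg_l (2 * d)); [lra|].
match goal with |- ?l <= _ => replace l with (RInt (fun x => S x * S x) (-1) 1 + d * d * 2) by (field; lra) end.
nra.
Qed.

(** * Weierstrass approximation by Bernstein polynomials *)

(** The mean of [u] under the binomial distribution of parameters [n] and [p], by
    conditioning on one trial. For [u k = w (k / n)] it is the Bernstein polynomial
    of [w] at [p]. *)
Fixpoint binom_mean (n : nat) (u : nat -> R) (p : R) : R :=
  match n with
  | O => u O
  | S m => p * binom_mean m (fun k => u (S k)) p + (1 - p) * binom_mean m u p
  end.

Lemma binom_mean_le n u v p : 0 <= p <= 1 ->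
  (forall k, (k <= n)%nat -> u k <= v k) -> binom_mean n u p <= binom_mean n v p.
Proof.
intros Hp; revert u v; induction n as [|n IH]; intros u v H; cbn [binom_mean].
- apply H; lia.
- apply Rplus_le_compat; apply Rmult_le_compat_l; try lra; apply IH; intros; apply H; lia.
Qed.

Lemma binom_mean_affine n u a c p :
  binom_mean n (fun k => a * u k + c) p = a * binom_mean n u p + c.
Proof.
revert u; induction n as [|n IH]; intros u; cbn [binom_mean]; [ring|].
rewrite (IH u), (IH (fun k => u (S k))). ring.
Qed.

Lemma binom_mean_ext n u v p : (forall k, u k = v k) -> binom_mean n u p = binom_mean n v p.
Proof.
revert u v; induction n as [|n IH]; intros u v H; cbn [binom_mean]; [apply H|].
rewrite (IH u v H), (IH (fun k => u (S k)) (fun k => v (S k))); [reflexivity|intros; apply H].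
Qed.

(** Variance plus squared bias of the binomial distribution about [a]. *)
Lemma binom_mean_sqr n a p :
  binom_mean n (fun k => (INR k - a) ^ 2) p = INR n * p * (1 - p) + (INR n * p - a) ^ 2.
Proof.
revert a; induction n as [|n IH]; intros a; [simpl; ring|].
cbn [binom_mean]. rewrite IH.
rewrite (binom_mean_ext n _ (fun k => (INR k - (a - 1)) ^ 2)).
- rewrite IH, S_INR. ring.
- intros k; rewrite S_INR; ring.
Qed.

Lemma in_span_binom_mean n u : in_span n (fun y => binom_mean n u ((1 + y) / 2)).
Proof.
revert u; induction n as [|n IH]; intros u; cbn [binom_mean]; [apply in_span_const|].
pose proof (IH (fun k => u (S k))) as A. pose proof (IH u) as B.
apply (in_span_ext _ (fun y => / 2 * (binom_mean n (fun k => u (S k)) ((1 + y) / 2)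
   + binom_mean n u ((1 + y) / 2)) + / 2 * (y * (binom_mean n (fun k => u (S k)) ((1 + y) / 2)
   + -1 * binom_mean n u ((1 + y) / 2))))).
- intros; field.
- apply in_span_plus; apply in_span_scal.
  + apply (in_span_mono n); [lia|]. now apply in_span_plus.
  + apply (in_span_mul n (fun y => binom_mean n (fun k => u (S k)) ((1 + y) / 2)
   + -1 * binom_mean n u ((1 + y) / 2))).
    apply in_span_plus; [|apply in_span_scal]; assumption.
Qed.

Lemma cont_bounded w a c : a <= c -> cont w ->
  exists M, 0 < M /\ forall x, a <= x <= c -> Rabs (w x) <= M.
Proof.
intros Hac Hw.
destruct (continuity_ab_maj (fun x => Rabs (w x)) a c Hac) as [m [Hm _]].
- intros x _. apply continuity_pt_filterlim.
  apply (continuous_comp w Rabs); [apply Hw|apply continuous_Rabs].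
- exists (Rabs (w m) + 1); split.
  + pose proof (Rabs_pos (w m)); lra.
  + intros x Hx. specialize (Hm x Hx). simpl in Hm. lra.
Qed.

(** Chebyshev's argument: where [k / n] is near [p] uniform continuity applies, and
    elsewhere the squared distance of [k / n] to [p], whose mean is at most [1 / n],
    dominates the oscillation of [w]. *)
Lemma bernstein_approx w eps : cont w -> 0 < eps ->
  exists n, forall p, 0 <= p <= 1 ->
    Rabs (w p - binom_mean n (fun k => w (INR k / INR n)) p) <= eps.
Proof.
intros Hw He.
destruct (cont_bounded w 0 1 ltac:(lra) Hw) as [M [HM HB]].
assert (He2 : 0 < eps / 2) by lra.
assert (Hw' : forall x, 0 <= x <= 1 -> continuity_pt w x)
  by (intros x _; apply continuity_pt_filterlim, Hw).
destruct (Heine_cor2 Hw' (mkposreal _ He2)) as [eta Heta].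
simpl in Heta. set (L := 2 * M / (eta * eta)).
pose proof (cond_pos eta) as Hpos.
assert (HL : 0 < L) by (apply Rdiv_lt_0_compat; nra).
destruct (INR_archimed (eps / 2) L He2) as [m Hm].
set (n := S m). exists n.
assert (Hn : 0 < INR n) by apply lt_0_INR, Nat.lt_0_succ.
assert (Hmn : L <= INR n * (eps / 2)).
{ unfold n; rewrite S_INR. nra. }
intros p Hp.
assert (K : forall k, (k <= n)%nat ->
  Rabs (w (INR k / INR n) - w p) <= L / (INR n * INR n) * (INR k - INR n * p) ^ 2 + eps / 2).
{ intros k Hk.
  assert (Hkn : 0 <= INR k / INR n <= 1).
  { apply le_INR in Hk. pose proof (pos_INR k). split.
    - apply Rdiv_le_0_compat; lra.
    - apply (Rmult_le_reg_r (INR n)); [lra|]. unfold Rdiv; rewrite Rmult_assoc, Rinv_l; lra. }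
  replace (L / (INR n * INR n) * (INR k - INR n * p) ^ 2)
    with (L * (INR k / INR n - p) ^ 2) by (field; lra).
  set (x := INR k / INR n) in *.
  destruct (Rlt_dec (Rabs (x - p)) eta) as [Hlt|Hge].
  - pose proof (Heta x p Hkn Hp Hlt). pose proof (pow2_ge_0 (x - p)). nra.
  - assert (eta * eta <= (x - p) ^ 2).
    { pose proof (Rsqr_abs (x - p)) as Q; unfold Rsqr in Q.
      replace ((x - p) ^ 2) with ((x - p) * (x - p)) by ring. rewrite Q. nra. }
    assert (2 * M <= L * (x - p) ^ 2).
    { replace (2 * M) with (L * (eta * eta)) by (unfold L; field; lra).
      apply Rmult_le_compat_l; lra. }
    pose proof (HB x Hkn). pose proof (HB p Hp).
    pose proof (Rabs_triang (w x) (- w p)). rewrite Rabs_Ropp in *.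
    unfold Rminus. lra. }
assert (V : binom_mean n (fun k => L / (INR n * INR n) * (INR k - INR n * p) ^ 2 + eps / 2) p <= eps).
{ rewrite binom_mean_affine, binom_mean_sqr.
  replace (L / (INR n * INR n) * (INR n * p * (1 - p) + (INR n * p - INR n * p) ^ 2))
    with (L / INR n * (p * (1 - p))) by (field; lra).
  assert (L / INR n <= eps / 2).
  { apply (Rmult_le_reg_r (INR n)); [lra|]. unfold Rdiv at 1. rewrite Rmult_assoc, Rinv_l; lra. }
  assert (0 < L / INR n) by (apply Rdiv_lt_0_compat; lra).
  assert (0 <= p * (1 - p) <= 1) by nra. nra. }
(* The two-sided estimate, one side for each sign s. *)
set (b := fun k => w (INR k / INR n)) in *.
assert (U : forall s, s = 1 \/ s = -1 -> s * binom_mean n b p - s * w p <= eps).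
{ intros s Hs. eapply Rle_trans; [|exact V].
  replace (s * binom_mean n b p - s * w p) with (s * binom_mean n b p + (- s * w p)) by ring.
  rewrite <- binom_mean_affine.
  apply binom_mean_le; [exact Hp|]. intros k Hk. eapply Rle_trans; [|exact (K k Hk)].
  fold (b k). pose proof (Rle_abs (b k - w p)). pose proof (Rle_abs (- (b k - w p))).
  rewrite Rabs_Ropp in *. destruct Hs as [-> | ->]; lra. }
pose proof (U 1 (or_introl eq_refl)). pose proof (U (-1) (or_intror eq_refl)).
apply Rabs_le_between; lra.
Qed.

Lemma weierstrass u eps : cont u -> 0 < eps ->
  exists n p, in_span n p /\ forall y, -1 <= y <= 1 -> Rabs (u y - p y) <= eps.
Proof.
intros Hu He.
destruct (bernstein_approx (fun x => u (2 * x - 1)) eps) as [n Hn]; [|exact He|].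
{ apply (cont_comp (fun x => 2 * x - 1)); [|exact Hu].
  apply cont_minus; [apply cont_mult; [apply cont_const|apply cont_id]|apply cont_const]. }
eexists n, _; split; [apply in_span_binom_mean|].
intros y Hy. specialize (Hn ((1 + y) / 2) ltac:(lra)). simpl in Hn.
replace (2 * ((1 + y) / 2) - 1) with y in Hn by field. exact Hn.
Qed.

(** * Uniform convergence of Legendre series *)

Lemma inner_legendre_parts r r' j :
  (forall y, is_derive r y (r' y)) -> cont r' ->
  inner r (legendre (S j))
  = / (2 * INR j + 3) * (inner r' (legendre j) - inner r' (legendre (S (S j)))).
Proof.
intros Hr Hc. pose proof (pos_INR j).
assert (Cr : cont r) by now apply (cont_derive _ r').
set (W := fun y => / (2 * INR j + 3) * (legendre (S (S j)) y - legendre j y)).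
assert (HW : forall y, is_derive W y (legendre (S j) y)).
{ intros y. replace (legendre (S j) y)
    with (/ (2 * INR j + 3) * (legendre' (S (S j)) y - legendre' j y))
    by (rewrite legendre'_diff; field; lra).
  apply is_derive_scal.
  apply (is_derive_minus (K := R_AbsRing) (V := R_NormedModule)); apply is_derive_legendre. }
assert (CW : cont W) by (eapply cont_derive, HW).
assert (E : RInt (fun y => r' y * W y + r y * legendre (S j) y) (-1) 1
   = r 1 * W 1 - r (-1) * W (-1)).
{ apply (RInt_of_derive (fun y => r y * W y)).
  - intros y. apply (is_derive_mult (K := R_AbsRing) r W); auto. intros; apply Rmult_comm.
  - apply cont_plus; apply cont_mult; auto. apply cont_legendre. }
rewrite RInt_plus_cont in E
  by (apply cont_mult; auto; apply cont_legendre).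
fold (inner r' W) (inner r (legendre (S j))) in E.
unfold W in E at 2 3. rewrite !legendre_at_1, !legendre_at_m1 in E. cbn [pow] in E.
assert (F : inner r' W = / (2 * INR j + 3) * (inner r' (legendre (S (S j))) - inner r' (legendre j))).
{ rewrite !(inner_sym r'). unfold W. rewrite inner_scal, inner_minus; auto using cont_legendre.
  apply cont_minus; apply cont_legendre. }
lra.
Qed.

(** In the sum of [legendre_coef r j * legendre j y], integration by parts makes each
    coefficient a difference of two inner products with [r']. Summation by parts moves
    this difference to the polynomials, where [RInt_legendre] identifies it as an
    integral of [legendre j]. *)
Lemma legendre_sum_parts r r' n y :
  (forall z, is_derive r z (r' z)) -> cont r' ->
  legendre_sum r n y
  = / 2 * inner r (legendre 0) - / 2 * (inner r' (legendre 0) - inner r' (legendre 1))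
    + RInt (legendre_sum r' (S n)) (-1) y
    - / 2 * inner r' (legendre n) * legendre (S n) y
    - / 2 * inner r' (legendre (S n)) * legendre (S (S n)) y.
Proof.
intros Hr Hc.
assert (I : forall m, RInt (legendre_sum r' (S m)) (-1) y
   = RInt (legendre_sum r' m) (-1) y
     + / 2 * inner r' (legendre (S m)) * (legendre (S (S m)) y - legendre m y)).
{ intros m. rewrite (RInt_ext_all _ (fun z => legendre_sum r' m z
     + legendre_coef r' (S m) * legendre (S m) z)).
  - rewrite RInt_plus_cont, RInt_scal_cont, RInt_legendre.
    + unfold legendre_coef. rewrite S_INR. pose proof (pos_INR m). as_R_eq; field. lra.
    + apply cont_legendre.
    + apply cont_legendre_sum.
    + apply cont_mult; [apply cont_const|apply cont_legendre].
  - intros z. apply sum_n_S. }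
induction n as [|n IH].
- rewrite I. unfold legendre_sum at 1. rewrite sum_O.
  rewrite (RInt_ext_all _ (fun z => legendre_coef r' 0 * legendre 0 z)).
  2:{ intros z; unfold legendre_sum; now rewrite sum_O. }
  rewrite RInt_scal_cont, RInt_legendre_0 by apply cont_legendre.
  unfold legendre_coef. simpl INR. change (legendre 0 y) with 1. change (legendre 1 y) with y.
  field.
- unfold legendre_sum at 1. rewrite sum_n_S. fold (legendre_sum r n y).
  rewrite IH, (I (S n)). unfold legendre_coef.
  rewrite (inner_legendre_parts r r' n Hr Hc), S_INR. pose proof (pos_INR n). field. lra.
Qed.

(** In [legendre_sum_parts] the integral is at most [2 * d], and so is each inner
    product with [r']; the inner product with [r] is at most [4 * d]. The weights
    give [8 * d]. *)
Lemma legendre_sum_bound r r' d n y :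
  (forall z, is_derive r z (r' z)) -> cont r' -> r (-1) = 0 -> 0 < d ->
  (forall z, -1 <= z <= 1 -> Rabs (r' z) <= d) -> -1 <= y <= 1 ->
  Rabs (r y) <= 2 * d /\ Rabs (legendre_sum r n y) <= 8 * d.
Proof.
intros Hr Hc H0 Hd Hb Hy.
assert (Cr : cont r) by now apply (cont_derive _ r').
assert (B : forall z, -1 <= z <= 1 -> Rabs (r z) <= 2 * d).
{ intros z Hz. rewrite <- (Rminus_0_r (r z)), <- H0, <- (RInt_of_derive r r' (-1) z Hr Hc).
  eapply Rle_trans; [apply (abs_RInt_le_const r' (-1) z d)|]; [lra|now apply ex_RInt_cont| |nra].
  intros; apply Hb; lra. }
assert (I : forall u j M, cont u -> (forall z, -1 <= z <= 1 -> Rabs (u z) <= M) ->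
   Rabs (inner u (legendre j)) <= 2 * M).
{ intros u j M Hu HM. replace (2 * M) with ((1 - -1) * M) by ring.
  apply abs_RInt_le_const; [lra|apply ex_RInt_cont, cont_mult; [exact Hu|apply cont_legendre]|].
  intros z Hz. rewrite Rabs_mult. pose proof (HM z Hz). pose proof (legendre_bound j z Hz).
  pose proof (Rabs_pos (u z)). pose proof (Rabs_pos (legendre j z)). nra. }
split; [now apply B|].
rewrite (legendre_sum_parts r r' n y Hr Hc).
pose proof (I r 0%nat (2 * d) Cr B) as A0.
pose proof (fun j => I r' j d Hc Hb) as A.
pose proof (RInt_legendre_sum_bound r' (S n) d y Hc Hd Hb Hy) as G.
assert (P : forall j k, Rabs (inner r' (legendre j) * legendre k y) <= 2 * d).
{ intros j k. rewrite Rabs_mult. pose proof (A j). pose proof (legendre_bound k y Hy).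
  pose proof (Rabs_pos (inner r' (legendre j))). pose proof (Rabs_pos (legendre k y)). nra. }
pose proof (A 0%nat) as A1. pose proof (A 1%nat) as A2.
pose proof (P n (S n)) as P1. pose proof (P (S n) (S (S n))) as P2.
apply Rabs_le_between in A0, A1, A2, G, P1, P2. apply Rabs_le_between. lra.
Qed.

Lemma legendre_sum_plus u v n y : cont u -> cont v ->
  legendre_sum (fun z => u z + v z) n y = legendre_sum u n y + legendre_sum v n y.
Proof.
intros Hu Hv. unfold legendre_sum.
rewrite <- (sum_n_plus (G := R_AbelianMonoid)).
apply sum_n_ext; intros j. unfold plus; simpl. unfold legendre_coef.
as_R_eq. rewrite inner_plus by (try apply cont_legendre; assumption). ring.
Qed.

Lemma legendre_series_uniform g g' :
  (forall y, is_derive g y (g' y)) -> cont g' ->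
  forall eps, 0 < eps -> exists N, forall n, (N <= n)%nat ->
  forall y, -1 <= y <= 1 -> Rabs (g y - legendre_sum g n y) < eps.
Proof.
intros Hg Hc eps He.
(* The bounds 2 d and 8 d for the remainder and its partial sum add up
   to half of eps. *)
assert (Hd : 0 < eps / 20) by lra.
destruct (weierstrass g' _ Hc Hd) as [m [p [Hp Hb]]].
pose proof (cont_in_span m p Hp) as Cp.
set (Q := fun y => g (-1) + RInt p (-1) y).
assert (SQ : in_span (S m) Q).
{ apply in_span_plus; [apply in_span_const|now apply in_span_RInt]. }
assert (DQ : forall y, is_derive Q y (p y)).
{ intros y. unfold Q. replace (p y) with (0 + p y) by ring.
  apply (is_derive_plus (K := R_AbsRing) (V := R_NormedModule)).
  - apply (is_derive_const (K := R_AbsRing) (V := R_NormedModule)).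
  - apply (is_derive_RInt p _ (-1)); [|apply Cp].
    apply filter_forall; intros z. apply (RInt_correct p), ex_RInt_cont, Cp. }
set (r := fun y => g y - Q y).
assert (Dr : forall y, is_derive r y (g' y - p y)).
{ intros y. now apply (is_derive_minus (K := R_AbsRing) (V := R_NormedModule)). }
assert (Cr : cont r) by (eapply cont_derive, Dr).
assert (CQ : cont Q) by (eapply cont_derive, DQ).
exists (S m). intros n Hn y Hy.
destruct (legendre_sum_bound r _ (eps / 20) n y Dr) as [B1 B2]; auto.
- now apply cont_minus.
- unfold r, Q. rewrite RInt_point. unfold zero; simpl. ring.
- replace (g y - legendre_sum g n y) with (r y - legendre_sum r n y).
  + apply Rabs_le_between in B1, B2. apply Rabs_lt_between. lra.
  + assert (E : legendre_sum g n y = legendre_sum r n y + legendre_sum Q n y).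
    { rewrite <- legendre_sum_plus by assumption.
      unfold legendre_sum. apply sum_n_ext; intros j. as_R_eq. f_equal.
      unfold legendre_coef. f_equal. apply inner_ext; intros z _. unfold r; R_ring. }
    rewrite E, (legendre_sum_span (S m) Q n y SQ Hn). unfold r; ring.
Qed.

(** * Parametric integrals *)

(** Compactness of [[0,1]] makes the continuity in the parameter uniform in the
    integration variable. The parameter space is arbitrary, so that one and two
    real parameters are covered together. *)
Lemma continuous_RInt_param {T : UniformSpace} (F : T -> R -> R) (p0 : T) :
  (forall p t, continuous (fun q : T * R => F (fst q) (snd q)) (p, t)) ->
  continuous (fun p => RInt (F p) 0 1) p0.
Proof.
intros HF.
assert (CF : forall p, cont (F p)).
{ intros p t. apply (continuous_comp_2 (fun _ => p) (fun t => t) F).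
  - apply continuous_const.
  - apply continuous_id.
  - apply HF. }
apply filterlim_locally; intros eps.
assert (He : 0 < eps / 3) by (pose proof (cond_pos eps); lra).
assert (D : forall t, exists d : posreal, forall p t', ball p0 d p -> Rabs (t' - t) < d ->
   Rabs (F p t' - F p0 t) < eps / 3).
{ intros t. destruct (proj1 (filterlim_locally _ _) (HF p0 t) (mkposreal _ He)) as [d Hd].
  exists d. intros p t' Hp Ht. apply (Hd (p, t')). split; [exact Hp|exact Ht]. }
pose (delta := fun t => proj1_sig (constructive_indefinite_description _ (D t))).
pose proof (fun t => proj2_sig (constructive_indefinite_description _ (D t))) as Hdelta.
change (forall t p t', ball p0 (delta t) p -> Rabs (t' - t) < delta t ->
  Rabs (F p t' - F p0 t) < eps / 3) in Hdelta.
destruct (compactness_value_1d 0 1 delta) as [d Hd].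
exists d. intros p Hp.
change (Rabs (RInt (F p) 0 1 - RInt (F p0) 0 1) < eps).
rewrite <- RInt_minus_cont by apply CF.
apply Rle_lt_trans with ((1 - 0) * (2 * (eps / 3))); [|lra].
apply abs_RInt_le_const; [lra|apply ex_RInt_cont, cont_minus; apply CF|].
intros x Hx.
destruct (Rle_dec (Rabs (F p x - F p0 x)) (2 * (eps / 3))) as [H|H]; [exact H|exfalso].
apply (Hd x Hx). intros [t [Ht [Hxt Hdt]]]. apply H.
pose proof (Hdelta t p x (ball_le _ _ _ Hdt _ Hp) Hxt) as A.
pose proof (Hdelta t p0 x (ball_center _ _) Hxt) as B.
apply Rabs_lt_between in A, B. apply Rabs_le_between. lra.
Qed.

Definition cont2 (F : R -> R -> R) : Prop :=
  forall p : R * R, continuous (fun p : R * R => F (fst p) (snd p)) p.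

(** Rescaling to a fixed interval reduces variable upper limits to
    [continuous_RInt_param]. *)
Lemma RInt_rescale f v : cont f -> RInt f 0 v = v * RInt (fun s => f (v * s)) 0 1.
Proof.
intros Hf. rewrite <- RInt_scal_cont.
- symmetry. pose proof (RInt_comp_lin f v 0 0 1) as H.
  replace (v * 0 + 0) with 0 in H by ring. replace (v * 1 + 0) with v in H by ring.
  rewrite <- H by now apply ex_RInt_cont.
  apply RInt_ext_all; intros s. unfold scal; simpl; unfold mult; simpl.
  now rewrite Rplus_0_r.
- apply (cont_comp (fun s => v * s)); [|exact Hf].
  apply cont_mult; [apply cont_const|apply cont_id].
Qed.

Lemma continuous_RInt_upper {T : UniformSpace} (F : T -> R -> R) (v : T -> R) (p0 : T) :
  (forall p t, continuous (fun q : T * R => F (fst q) (snd q)) (p, t)) ->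
  (forall p, continuous v p) ->
  continuous (fun p => RInt (F p) 0 (v p)) p0.
Proof.
intros HF Hv.
apply (continuous_ext (fun p => v p * RInt (fun s => F p (v p * s)) 0 1)).
- intros p. symmetry. apply RInt_rescale. intros t.
  apply (continuous_comp_2 (fun _ => p) (fun t => t) F).
  + apply continuous_const.
  + apply continuous_id.
  + apply HF.
- apply (continuous_mult v); [apply Hv|].
  apply (continuous_RInt_param (fun p s => F p (v p * s))).
  intros p t. apply (continuous_comp_2 fst (fun q : T * R => v (fst q) * snd q) F).
  + apply continuous_fst.
  + apply (continuous_mult (fun q : T * R => v (fst q))).
    * apply (continuous_comp fst v); [apply continuous_fst|apply Hv].
    * apply continuous_snd.
  + apply HF.
Qed.

Lemma cont2_slice F x : cont2 F -> cont (F x).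
Proof.
intros HF t. apply (continuous_comp_2 (fun _ => x) (fun t => t) F).
- apply continuous_const.
- apply continuous_id.
- apply (HF (x, t)).
Qed.

Lemma continuous_comp2 {T : UniformSpace} (F : R -> R -> R) (a b : T -> R) p :
  cont2 F -> continuous a p -> continuous b p -> continuous (fun q => F (a q) (b q)) p.
Proof.
intros HF Ha Hb. apply (continuous_comp_2 a b F); auto.
Qed.

(** Leibniz's rule with hypotheses stated globally, which is what continuous
    extensions of the data provide. *)
Lemma is_derive_RInt_both (F F1 : R -> R -> R) (a c : R -> R) (x da dc : R) :
  cont2 F -> cont2 F1 -> (forall x t, is_derive (fun z => F z t) x (F1 x t)) ->
  is_derive a x da -> is_derive c x dc ->
  is_derive (fun z => RInt (F z) (a z) (c z)) x
    (RInt (F1 x) (a x) (c x) - F x (a x) * da + F x (c x) * dc).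
Proof.
intros HF HF1 HD Ha Hc.
assert (DE : forall u v, Derive (fun z => F z v) u = F1 u v)
  by (intros; now apply is_derive_unique).
assert (C2 : forall u v, continuity_2d_pt (fun u v => Derive (fun z => F z v) u) u v).
{ intros u v. apply (continuity_2d_pt_ext F1); [now intros|].
  apply continuity_2d_pt_filterlim, (HF1 (u, v)). }
replace (RInt (F1 x) (a x) (c x) - F x (a x) * da + F x (c x) * dc) with
 (RInt (fun t => Derive (fun u => F u t) x) (a x) (c x) + - F x (a x) * da + F x (c x) * dc).
2:{ rewrite (RInt_ext_all _ (F1 x)) by (intros; apply DE). ring. }
apply is_derive_RInt_param_bound_comp; auto.
- apply filter_forall; intros; now apply ex_RInt_cont, cont2_slice.
- exists (mkposreal 1 Rlt_0_1). apply filter_forall; intros; now apply ex_RInt_cont, cont2_slice.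
- exists (mkposreal 1 Rlt_0_1). apply filter_forall; intros; now apply ex_RInt_cont, cont2_slice.
- exists (mkposreal 1 Rlt_0_1). apply filter_forall; intros y t _. exists (F1 y t). apply HD.
- exists (mkposreal 1 Rlt_0_1); intros; apply C2.
- exists (mkposreal 1 Rlt_0_1); intros; apply C2.
- apply continuity_pt_filterlim, (cont2_slice F x HF).
- apply continuity_pt_filterlim, (cont2_slice F x HF).
Qed.

(** * Continuity in two variables *)

Ltac derive_with tac := eapply is_derive_eq; [tac|].

Lemma cont2_mult F G : cont2 F -> cont2 G -> cont2 (fun x t => F x t * G x t).
Proof. intros HF HG p. exact (continuous_mult (fun p => F (fst p) (snd p)) _ p (HF p) (HG p)). Qed.

Lemma cont2_plus F G : cont2 F -> cont2 G -> cont2 (fun x t => F x t + G x t).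
Proof. intros HF HG p. exact (continuous_plus (fun p => F (fst p) (snd p)) _ p (HF p) (HG p)). Qed.

Lemma cont2_minus F G : cont2 F -> cont2 G -> cont2 (fun x t => F x t - G x t).
Proof. intros HF HG p. exact (continuous_minus (fun p => F (fst p) (snd p)) _ p (HF p) (HG p)). Qed.

Lemma cont2_const c : cont2 (fun _ _ => c).
Proof. intros p; apply continuous_const. Qed.

Lemma cont2_fst : cont2 (fun x _ => x).
Proof. intros p; apply continuous_fst. Qed.

Lemma cont2_snd : cont2 (fun _ t => t).
Proof. intros p; apply continuous_snd. Qed.

Lemma cont2_comp1 (f : R -> R) (a : R -> R -> R) : cont f -> cont2 a ->
  cont2 (fun x t => f (a x t)).
Proof.
intros Hf Ha p. apply (continuous_comp (fun p => a (fst p) (snd p)) f); [apply Ha|apply Hf].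
Qed.

Lemma cont2_comp (F a c : R -> R -> R) : cont2 F -> cont2 a -> cont2 c ->
  cont2 (fun x t => F (a x t) (c x t)).
Proof. intros HF Ha Hc p. apply (continuous_comp2 F (fun p => a (fst p) (snd p))); auto. Qed.

Lemma cont2_affine a c d : cont2 (fun x t => a * x + c * t + d).
Proof.
apply cont2_plus; [apply cont2_plus; apply cont2_mult|];
  auto using cont2_const, cont2_fst, cont2_snd.
Qed.

Lemma cont2_ext F G : (forall x t, F x t = G x t) -> cont2 F -> cont2 G.
Proof.
intros H HF p. apply (continuous_ext (fun p => F (fst p) (snd p))); [intros; apply H|apply HF].
Qed.

Lemma RInt_reflect f x : cont f ->
  RInt f (- x) x = RInt (fun w => f (x - w)) 0 (2 * x).
Proof.
intros Hf. pose proof (RInt_comp_lin f (-1) x 0 (2 * x)) as H.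
replace (-1 * 0 + x) with x in H by ring.
replace (-1 * (2 * x) + x) with (- x) in H by ring.
replace (RInt f (- x) x) with (- RInt f x (- x))
  by (apply (opp_RInt_swap f x (- x)); now apply ex_RInt_cont).
rewrite <- H by now apply ex_RInt_cont.
transitivity (- (-1 * RInt (fun w => f (x - w)) 0 (2 * x))); [|as_R_eq; ring].
f_equal. rewrite <- RInt_scal_cont.
- apply RInt_ext_all; intros w. unfold scal; simpl; unfold mult; simpl. do 2 f_equal. ring.
- apply (cont_comp (fun w => x - w)); [|exact Hf].
  apply cont_minus; [apply cont_const|apply cont_id].
Qed.

Lemma RInt_shift f x : cont f ->
  RInt f (- x) x = RInt (fun w => f (w - x)) 0 (2 * x).
Proof.
intros Hf. pose proof (RInt_comp_lin f 1 (- x) 0 (2 * x)) as H.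
replace (1 * 0 + - x) with (- x) in H by ring.
replace (1 * (2 * x) + - x) with x in H by ring.
rewrite <- H by now apply ex_RInt_cont.
apply RInt_ext_all; intros w. unfold scal; simpl; unfold mult; simpl. rewrite !Rmult_1_l.
reflexivity.
Qed.

(** * Moments of the solution of a Goursat problem *)

Section Kernel.

Variables (h : R) (q : R -> R) (Q : R -> R -> R).
Hypotheses (Hq : cont q) (HQ : cont2 Q).

(** In the characteristic coordinates [al = (x + t) / 2] and [be = (x - t) / 2] of
    the wave equation, the integral of the source along a line [x + t = constant]. *)
Definition char_int (al v : R) : R := RInt (fun be => Q (al + be) (al - be)) 0 v.

(** The derivative of [kernel] in the coordinate [(x + t) / 2], the other one being
    fixed. *)
Definition goursat_density (al v : R) : R := q al / 2 + char_int al v.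

(** The right-hand side of the integral equation of the transmutation kernel, with
    [Q] standing for the product of potential and kernel. It is linear in
    [(h, q, Q)], so real and imaginary parts are treated separately. *)
Definition kernel (x t : R) : R :=
  h / 2 + RInt (fun al => goursat_density al ((x - t) / 2)) 0 ((x + t) / 2).

Definition moment (p : R -> R) (x : R) : R := RInt (fun t => kernel x t * p t) (- x) x.

Definition density_moment (p : R -> R) (x : R) : R :=
  RInt (fun t => goursat_density ((x + t) / 2) ((x - t) / 2) * p t) (- x) x.

Definition source_moment (p : R -> R) (x : R) : R := RInt (fun t => Q x t * p t) (- x) x.

Lemma cont2_diag : cont2 (fun al be => Q (al + be) (al - be)).
Proof.
apply cont2_comp; [exact HQ|apply cont2_plus|apply cont2_minus];
 auto using cont2_fst, cont2_snd.
Qed.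

Lemma cont2_char_int : cont2 char_int.
Proof.
intros p. apply (continuous_RInt_upper (fun (p : R * R) be => Q (fst p + be) (fst p - be)) snd).
- intros p1 t. apply (continuous_comp2 Q (fun q : R * R * R => fst (fst q) + snd q)
    (fun q : R * R * R => fst (fst q) - snd q)); [exact HQ| |].
  + apply (continuous_plus (fun q : R * R * R => fst (fst q))); [|apply continuous_snd].
    apply (continuous_comp fst fst); apply continuous_fst.
  + apply (continuous_minus (fun q : R * R * R => fst (fst q))); [|apply continuous_snd].
    apply (continuous_comp fst fst); apply continuous_fst.
- intros p1; apply continuous_snd.
Qed.

Lemma cont2_density : cont2 goursat_density.
Proof.
apply cont2_plus; [|exact cont2_char_int].
apply (cont2_comp1 (fun x => q x / 2) (fun x _ => x)); [|apply cont2_fst].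
apply (cont_mult q (fun _ => / 2)); [exact Hq|apply cont_const].
Qed.

Lemma cont2_kernel : cont2 kernel.
Proof.
intros p. unfold kernel.
apply (continuous_plus (fun _ : R * R => h / 2)); [apply continuous_const|].
apply (continuous_RInt_upper (fun (p : R * R) al => goursat_density al ((fst p - snd p) / 2))
  (fun p : R * R => (fst p + snd p) / 2)).
- intros p1 t. apply (continuous_comp2 goursat_density (fun q : R * R * R => snd q)
    (fun q : R * R * R => (fst (fst q) - snd (fst q)) / 2)).
  + exact cont2_density.
  + apply continuous_snd.
  + apply (continuous_comp fst (fun p : R * R => (fst p - snd p) / 2)); [apply continuous_fst|].
    apply (cont2_comp1 (fun z => z / 2) (fun x t => x - t)).
    * apply (cont_mult (fun z => z) (fun _ => / 2)); [apply cont_id|apply cont_const].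
    * apply cont2_minus; [apply cont2_fst|apply cont2_snd].
- intros p1. apply (cont2_comp1 (fun z => z / 2) (fun x t => x + t)).
    * apply (cont_mult (fun z => z) (fun _ => / 2)); [apply cont_id|apply cont_const].
    * apply cont2_plus; [apply cont2_fst|apply cont2_snd].
Qed.

Lemma is_derive_char_int al v : is_derive (char_int al) v (Q (al + v) (al - v)).
Proof.
apply (is_derive_RInt (fun be => Q (al + be) (al - be)) _ 0).
- apply filter_forall; intros z. apply (RInt_correct (V := R_CompleteNormedModule)), ex_RInt_cont.
  exact (cont2_slice _ al cont2_diag).
- exact (cont2_slice _ al cont2_diag v).
Qed.

Lemma kernel_char x w : kernel x (x - w)
  = h / 2 + RInt (fun al => goursat_density al (w / 2)) 0 (x - w / 2).
Proof.
unfold kernel. f_equal.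
replace ((x + (x - w)) / 2) with (x - w / 2) by field.
apply RInt_ext_all; intros; do 2 f_equal; field.
Qed.

Lemma cont_density_l v : cont (fun al => goursat_density al v).
Proof.
intros al. apply (continuous_comp2 goursat_density (fun al => al) (fun _ => v)).
- exact cont2_density.
- apply continuous_id.
- apply continuous_const.
Qed.

Lemma is_derive_kernel_char x w :
  is_derive (fun z => kernel z (z - w)) x (goursat_density (x - w / 2) (w / 2)).
Proof.
apply (is_derive_ext
  (fun z => h / 2 + RInt (fun al => goursat_density al (w / 2)) 0 (z - w / 2))).
{ intros z; symmetry; apply kernel_char. }
derive_with ltac:(
  apply (is_derive_plus (K := R_AbsRing) (V := R_NormedModule) (fun _ => h / 2));
  [apply (is_derive_const (K := R_AbsRing) (V := R_NormedModule))
  |apply (is_derive_comp (fun y => RInt (fun al => goursat_density al (w / 2)) 0 y)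
     (fun z => z - w / 2));
   [apply (is_derive_RInt (fun al => goursat_density al (w / 2)) _ 0);
     [apply filter_forall; intros z;
      apply (RInt_correct (V := R_CompleteNormedModule)), ex_RInt_cont, cont_density_l
     |apply cont_density_l]
   |apply (is_derive_minus (K := R_AbsRing) (V := R_NormedModule) (fun z => z));
     [apply (is_derive_id (K := R_AbsRing))
     |apply (is_derive_const (K := R_AbsRing) (V := R_NormedModule))]]]).
unfold plus, scal, minus, opp, zero, one; simpl. unfold plus, mult; simpl. R_ring.
Qed.

Lemma kernel_left x : kernel x (- x) = h / 2.
Proof.
unfold kernel. replace ((x + - x) / 2) with 0 by field.
rewrite RInt_point. unfold zero; simpl; R_ring.
Qed.

Lemma is_derive_shift (p p' : R -> R) (w x : R) : (forall t, is_derive p t (p' t)) ->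
  is_derive (fun z => p (z - w)) x (p' (x - w)).
Proof.
intros Hp. derive_with ltac:(apply (is_derive_comp p (fun z => z - w));
  [apply Hp|apply (is_derive_minus (K := R_AbsRing) (V := R_NormedModule) (fun z => z));
     [apply (is_derive_id (K := R_AbsRing))
     |apply (is_derive_const (K := R_AbsRing) (V := R_NormedModule))]]).
unfold scal, minus, plus, opp, zero, one; simpl. unfold mult; simpl. R_ring.
Qed.

Lemma is_derive_reflect (p p' : R -> R) (w x : R) : (forall t, is_derive p t (p' t)) ->
  is_derive (fun z => p (w - z)) x (- p' (w - x)).
Proof.
intros Hp. derive_with ltac:(apply (is_derive_comp p (fun z => w - z));
  [apply Hp|apply (is_derive_minus (K := R_AbsRing) (V := R_NormedModule) (fun _ => w));
     [apply (is_derive_const (K := R_AbsRing) (V := R_NormedModule))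
     |apply (is_derive_id (K := R_AbsRing))]]).
unfold scal, minus, plus, opp, zero, one; simpl. unfold mult; simpl. R_ring.
Qed.

Lemma cont2_lin (F : R -> R -> R) a c d e : cont2 F ->
  cont2 (fun x t => F (a * x + c * t) (d * x + e * t)).
Proof.
intros HF. apply cont2_comp; [exact HF| |].
- apply (cont2_ext (fun x t => a * x + c * t + 0)); [intros; ring|apply cont2_affine].
- apply (cont2_ext (fun x t => d * x + e * t + 0)); [intros; ring|apply cont2_affine].
Qed.

Lemma cont2_lin1 (f : R -> R) a c : cont f -> cont2 (fun x t => f (a * x + c * t)).
Proof.
intros Hf. apply cont2_comp1; [exact Hf|].
apply (cont2_ext (fun x t => a * x + c * t + 0)); [intros; ring|apply cont2_affine].
Qed.

Ltac lin_eq := intros; repeat (f_equal; try field).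

(** With [w = x - t] as integration variable, the derivative in [x] of the kernel at
    constant [w] is [goursat_density], and the moving end [w = 2 * x] is the point
    [t = - x], where the kernel equals [h / 2]. *)
Lemma is_derive_moment p p' (x : R) : (forall t, is_derive p t (p' t)) -> cont p' ->
  is_derive (moment p) x (h * p (- x) + moment p' x + density_moment p x).
Proof.
intros Hp Hp'. assert (Cp : cont p) by (eapply cont_derive, Hp).
assert (CK : forall r z, cont r -> cont (fun t => kernel z t * r t)).
{ intros r z Hr. apply cont_mult; [apply (cont2_slice kernel z cont2_kernel)|exact Hr]. }
apply (is_derive_ext (fun z => RInt (fun w => kernel z (z - w) * p (z - w)) 0 (2 * z))).
{ intros z. as_R_eq. symmetry. apply (RInt_reflect (fun t => kernel z t * p t)); auto. }
set (F1 := fun z w => goursat_density (z - w / 2) (w / 2) * p (z - w) + kernel z (z - w) * p' (z - w)).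
assert (K1 : cont2 (fun z w => kernel z (z - w))).
{ apply (cont2_ext (fun z w => kernel (1 * z + 0 * w) (1 * z + -1 * w))); [lin_eq|].
  apply cont2_lin, cont2_kernel. }
assert (P1 : forall r, cont r -> cont2 (fun z w => r (z - w))).
{ intros r Hr. apply (cont2_ext (fun z w => r (1 * z + -1 * w))); [lin_eq|now apply cont2_lin1]. }
assert (D1 : cont2 (fun z w => goursat_density (z - w / 2) (w / 2))).
{ apply (cont2_ext (fun z w => goursat_density (1 * z + - / 2 * w) (0 * z + / 2 * w))); [lin_eq|].
  apply cont2_lin, cont2_density. }
assert (CF1 : cont2 F1) by (apply cont2_plus; apply cont2_mult; auto).
match goal with |- is_derive ?F x ?d => replace d with
  (RInt (F1 x) 0 (2 * x) - kernel x (x - 0) * p (x - 0) * 0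
     + kernel x (x - 2 * x) * p (x - 2 * x) * 2) end.
- apply (is_derive_RInt_both (fun z w => kernel z (z - w) * p (z - w)) F1
    (fun _ => 0) (fun z => 2 * z)).
  + apply cont2_mult; auto.
  + exact CF1.
  + intros z t. unfold F1.
    apply (is_derive_mult (K := R_AbsRing) (fun z => kernel z (z - t)) (fun z => p (z - t))).
    * apply is_derive_kernel_char.
    * now apply is_derive_shift.
    * intros; apply Rmult_comm.
  + apply (is_derive_const (K := R_AbsRing) (V := R_NormedModule)).
  + derive_with ltac:(apply is_derive_scal, (is_derive_id (K := R_AbsRing))).
    unfold one; simpl; R_ring.
- replace (x - 2 * x) with (- x) by ring. rewrite kernel_left.
  assert (E : RInt (F1 x) 0 (2 * x) = moment p' x + density_moment p x).
  { unfold moment, density_moment.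
    rewrite (RInt_reflect (fun t => kernel x t * p' t)) by auto.
    rewrite (RInt_reflect (fun t => goursat_density ((x + t) / 2) ((x - t) / 2) * p t)).
    - rewrite <- RInt_plus_cont.
      + apply RInt_ext_all; intros w. unfold F1.
        replace ((x + (x - w)) / 2) with (x - w / 2) by field.
        replace ((x - (x - w)) / 2) with (w / 2) by field. ring.
      + apply (cont2_slice (fun x w => kernel x (x - w) * p' (x - w))), cont2_mult; auto.
      + apply cont_mult.
        * apply (cont2_slice (fun x w => goursat_density ((x + (x - w)) / 2) ((x - (x - w)) / 2))).
          apply (cont2_ext (fun z w => goursat_density (z - w / 2) (w / 2))); [lin_eq|exact D1].
        * apply (cont2_slice (fun x w => p (x - w))); auto.
    - apply cont_mult; [|exact Cp].
      apply (cont2_slice (fun x t => goursat_density ((x + t) / 2) ((x - t) / 2))).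
      apply (cont2_ext (fun z w => goursat_density (/ 2 * z + / 2 * w) (/ 2 * z + - / 2 * w))); [lin_eq|].
      apply cont2_lin, cont2_density. }
  rewrite E. apply Rminus_diag_uniq; field.
Qed.

(** With [w = x + t] as integration variable, the derivative in [x] of
    [goursat_density] at constant [w] is the source [Q], and the moving end
    [w = 2 * x] is the point [t = x], where [goursat_density] equals [q x / 2]. *)
Lemma is_derive_density_moment p p' (x : R) : (forall t, is_derive p t (p' t)) -> cont p' ->
  is_derive (density_moment p) x (q x * p x + source_moment p x - density_moment p' x).
Proof.
intros Hp Hp'. assert (Cp : cont p) by (eapply cont_derive, Hp).
set (D := fun z w => goursat_density (w / 2) (z - w / 2)).
assert (CD : cont2 D).
{ apply (cont2_ext (fun z w => goursat_density (0 * z + / 2 * w) (1 * z + - / 2 * w))); [unfold D; lin_eq|].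
  apply cont2_lin, cont2_density. }
assert (P1 : forall r, cont r -> cont2 (fun z w => r (w - z))).
{ intros r Hr. apply (cont2_ext (fun z w => r (-1 * z + 1 * w))); [lin_eq|now apply cont2_lin1]. }
assert (CQ : cont2 (fun z w => Q z (w - z))).
{ apply (cont2_ext (fun z w => Q (1 * z + 0 * w) (-1 * z + 1 * w))); [lin_eq|].
  apply cont2_lin, HQ. }
assert (S : forall r z, cont r ->
  density_moment r z = RInt (fun w => D z w * r (w - z)) 0 (2 * z)).
{ intros r z Hr. unfold density_moment.
  rewrite (RInt_shift (fun t => goursat_density ((z + t) / 2) ((z - t) / 2) * r t)).
  - apply RInt_ext_all; intros w. unfold D.
    replace ((z + (w - z)) / 2) with (w / 2) by field.
    replace ((z - (w - z)) / 2) with (z - w / 2) by field. reflexivity.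
  - apply cont_mult; [|exact Hr].
    apply (cont2_slice (fun x t => goursat_density ((x + t) / 2) ((x - t) / 2))).
    apply (cont2_ext (fun z w => goursat_density (/ 2 * z + / 2 * w) (/ 2 * z + - / 2 * w))); [lin_eq|].
    apply cont2_lin, cont2_density. }
apply (is_derive_ext (fun z => RInt (fun w => D z w * p (w - z)) 0 (2 * z))).
{ intros z. as_R_eq. symmetry. now apply S. }
set (F1 := fun z w => Q z (w - z) * p (w - z) + D z w * - p' (w - z)).
assert (CF1 : cont2 F1).
{ apply cont2_plus; apply cont2_mult; auto.
  apply (cont2_ext (fun z w => -1 * p' (w - z))); [intros; ring|].
  apply cont2_mult; [apply cont2_const|auto]. }
match goal with |- is_derive ?F x ?d => replace d with
  (RInt (F1 x) 0 (2 * x) - D x 0 * p (0 - x) * 0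
     + D x (2 * x) * p (2 * x - x) * 2) end.
- apply (is_derive_RInt_both (fun z w => D z w * p (w - z)) F1
    (fun _ => 0) (fun z => 2 * z)).
  + apply cont2_mult; auto.
  + exact CF1.
  + intros z t. unfold F1.
    apply (is_derive_mult (K := R_AbsRing) (fun z => D z t) (fun z => p (t - z))).
    * unfold D, goursat_density.
      derive_with ltac:(
        apply (is_derive_plus (K := R_AbsRing) (V := R_NormedModule) (fun _ => q (t / 2) / 2));
        [apply (is_derive_const (K := R_AbsRing) (V := R_NormedModule))
        |apply (is_derive_shift (char_int (t / 2))), is_derive_char_int]).
      unfold plus, zero; simpl. as_R_eq. rewrite Rplus_0_l. f_equal; field.
    * now apply is_derive_reflect.
    * intros; apply Rmult_comm.
  + apply (is_derive_const (K := R_AbsRing) (V := R_NormedModule)).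
  + derive_with ltac:(apply is_derive_scal, (is_derive_id (K := R_AbsRing))).
    unfold one; simpl; R_ring.
- replace (2 * x - x) with x by ring.
  assert (D0 : D x (2 * x) = q x / 2).
  { unfold D, goursat_density, char_int. replace (2 * x / 2) with x by field.
    replace (x - x) with 0 by ring. rewrite RInt_point. unfold zero; simpl; R_ring. }
  assert (E : RInt (F1 x) 0 (2 * x) = source_moment p x - density_moment p' x).
  { rewrite (S p' x Hp'). unfold source_moment.
    rewrite (RInt_shift (fun t => Q x t * p t)).
    - rewrite <- RInt_minus_cont.
      + apply RInt_ext_all; intros w. unfold F1. R_ring.
      + apply (cont2_slice (fun x w => Q x (w - x) * p (w - x))), cont2_mult; auto.
      + apply (cont2_slice (fun x w => D x w * p' (w - x))), cont2_mult; auto.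
    - apply cont_mult; [apply (cont2_slice Q x HQ)|exact Cp]. }
  rewrite E, D0. apply Rminus_diag_uniq; field.
Qed.

Definition kernel_dt (x t : R) : R :=
  / 2 * goursat_density ((x + t) / 2) ((x - t) / 2)
  - / 2 * RInt (fun al => Q (al + (x - t) / 2) (al - (x - t) / 2)) 0 ((x + t) / 2).

Lemma is_derive_kernel x t : is_derive (kernel x) t (kernel_dt x t).
Proof.
unfold kernel.
derive_with ltac:(
 apply (is_derive_plus (K := R_AbsRing) (V := R_NormedModule) (fun _ => h / 2));
 [apply (is_derive_const (K := R_AbsRing) (V := R_NormedModule))
 |apply (is_derive_RInt_both (fun t al => goursat_density al ((x - t) / 2))
   (fun t al => - / 2 * Q (al + (x - t) / 2) (al - (x - t) / 2))
   (fun _ => 0) (fun t => (x + t) / 2) t 0 (/ 2))]).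
- apply (cont2_comp goursat_density (fun _ al => al) (fun t _ => (x - t) / 2)).
  + exact cont2_density.
  + apply cont2_snd.
  + apply (cont2_ext (fun t al => - / 2 * t + 0 * al + x / 2)); [intros; field|apply cont2_affine].
- apply cont2_mult; [apply cont2_const|].
  apply cont2_comp; [exact HQ| |].
  + apply (cont2_ext (fun t al => - / 2 * t + 1 * al + x / 2)); [intros; field|apply cont2_affine].
  + apply (cont2_ext (fun t al => / 2 * t + 1 * al + - x / 2)); [intros; field|apply cont2_affine].
- intros z al. unfold goursat_density.
  derive_with ltac:(
    apply (is_derive_plus (K := R_AbsRing) (V := R_NormedModule) (fun _ => q al / 2));
    [apply (is_derive_const (K := R_AbsRing) (V := R_NormedModule))
    |apply (is_derive_comp (char_int al) (fun t => (x - t) / 2));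
     [apply is_derive_char_int|]]).
  + instantiate (1 := - / 2). auto_derive; [exact I|field].
  + unfold plus, zero, scal; simpl. unfold mult; simpl. R_ring.
- apply (is_derive_const (K := R_AbsRing) (V := R_NormedModule)).
- auto_derive; [exact I|field].
- unfold plus, zero, kernel_dt; simpl. as_R_eq.
  rewrite RInt_scal_cont.
  + ring.
  + apply (cont2_slice (fun v al => Q (al + v) (al - v))).
    apply cont2_comp; [exact HQ|apply cont2_plus|apply cont2_minus];
     auto using cont2_fst, cont2_snd.
Qed.

Lemma cont_kernel_dt x : cont (kernel_dt x).
Proof.
unfold kernel_dt. apply cont_minus; (apply cont_mult; [apply cont_const|]).
- apply (cont2_slice (fun x t => goursat_density ((x + t) / 2) ((x - t) / 2))).
  apply (cont2_ext (fun z w => goursat_density (/ 2 * z + / 2 * w) (/ 2 * z + - / 2 * w))); [lin_eq|].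
  apply cont2_lin, cont2_density.
- intros t. apply (continuous_RInt_upper
   (fun t al => Q (al + (x - t) / 2) (al - (x - t) / 2)) (fun t => (x + t) / 2)).
  + intros z al. apply (cont2_comp Q (fun t al => al + (x - t) / 2) (fun t al => al - (x - t) / 2) HQ).
    * apply (cont2_ext (fun t al => - / 2 * t + 1 * al + x / 2)); [intros; field|apply cont2_affine].
    * apply (cont2_ext (fun t al => / 2 * t + 1 * al + - x / 2)); [intros; field|apply cont2_affine].
  + intros z. apply (cont2_slice (fun _ t => (x + t) / 2) 0).
    apply (cont2_ext (fun z t => 0 * z + / 2 * t + x / 2)); [intros; field|apply cont2_affine].
Qed.

End Kernel.

(** * Complex-valued functions *)

(** The retraction of the line onto [[0,b]]. Composition with it turns continuity
    within [[0,b]] into continuity on the line. *)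
Definition clamp (b s : R) : R := Rmax 0 (Rmin b s).

Lemma clamp_in b s : 0 < b -> 0 <= clamp b s <= b.
Proof.
intros Hb. unfold clamp. split; [apply Rmax_l|].
apply Rmax_lub; [lra|apply Rmin_l].
Qed.

Lemma clamp_id b s : 0 <= s <= b -> clamp b s = s.
Proof. intros Hs. unfold clamp. rewrite Rmin_right, Rmax_right; lra. Qed.

Lemma continuous_Rmax {T : UniformSpace} (f g : T -> R) p :
  continuous f p -> continuous g p -> continuous (fun z => Rmax (f z) (g z)) p.
Proof.
intros Hf Hg.
apply (continuous_ext (fun z => (f z + g z + Rabs (f z - g z)) * / 2)).
- intros z. unfold Rmax, Rabs. destruct Rle_dec, Rcase_abs; as_R_eq; lra.
- apply (continuous_mult (fun z => f z + g z + Rabs (f z - g z))); [|apply continuous_const].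
  apply (continuous_plus (fun z => f z + g z)); [now apply (continuous_plus f g)|].
  apply (continuous_comp (fun z => f z - g z) Rabs); [now apply (continuous_minus f g)|].
  apply continuous_Rabs.
Qed.

Lemma continuous_Rmin {T : UniformSpace} (f g : T -> R) p :
  continuous f p -> continuous g p -> continuous (fun z => Rmin (f z) (g z)) p.
Proof.
intros Hf Hg.
apply (continuous_ext (fun z => - Rmax (- f z) (- g z))).
- intros z. as_R_eq. rewrite Rmax_opp_Rmin. apply Ropp_involutive.
- apply (continuous_opp (fun z => Rmax (- f z) (- g z))).
  apply continuous_Rmax; [now apply (continuous_opp f)|now apply (continuous_opp g)].
Qed.

Lemma cont_clamp b : cont (clamp b).
Proof.
intros x. apply (continuous_Rmax (fun _ => 0)); [apply continuous_const|].
apply (continuous_Rmin (fun _ => b) (fun s => s)); [apply continuous_const|apply continuous_id].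
Qed.

Lemma continuous_retract {T U : UniformSpace} (D : T -> Prop) (g : T -> U) (r : T -> T) p :
  continuous_on D g -> (forall p, D (r p)) -> continuous r p -> continuous (fun z => g (r z)) p.
Proof.
intros Hg Hr Hc. unfold continuous.
apply (filterlim_comp _ _ _ r g _ (within D (locally (r p)))).
- intros P HP. specialize (Hc _ HP). unfold filtermap in *.
  revert Hc. apply filter_imp. intros z Hz. apply Hz, Hr.
- apply Hg, Hr.
Qed.

Definition ccont (g : R -> C) : Prop := cont (fun x => fst (g x)) /\ cont (fun x => snd (g x)).

Lemma ccont_const c : ccont (fun _ => c).
Proof. split; apply cont_const. Qed.

Lemma ccont_minus g k : ccont g -> ccont k -> ccont (fun x => g x - k x)%C.
Proof. intros [A B] [A' B']; split; now apply cont_minus. Qed.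

Lemma ccont_mult g k : ccont g -> ccont k -> ccont (fun x => g x * k x)%C.
Proof.
intros [A B] [A' B']; split.
- apply cont_minus; now apply cont_mult.
- apply cont_plus; now apply cont_mult.
Qed.

Lemma Csqr_norm_neq_0 (z : C) : z <> 0%C -> fst z ^ 2 + snd z ^ 2 <> 0.
Proof.
intros Hz H. apply Hz. destruct z as [a c]; simpl in H.
apply injective_projections; simpl; nra.
Qed.

Lemma cont_inv g : cont g -> (forall x, g x <> 0) -> cont (fun x => / g x).
Proof. intros Hg H x. apply (continuous_comp g Rinv); [apply Hg|]. now apply continuous_Rinv. Qed.

Lemma ccont_inv g : ccont g -> (forall x, g x <> 0%C) -> ccont (fun x => / g x)%C.
Proof.
intros [A B] H.
assert (N : cont (fun x => / (fst (g x) ^ 2 + snd (g x) ^ 2))).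
{ apply (cont_inv (fun x => fst (g x) ^ 2 + snd (g x) ^ 2)).
  - apply cont_plus; apply (cont_mult _ (fun x => _ * 1)); auto;
      apply cont_mult; auto using cont_const.
  - intros x; apply Csqr_norm_neq_0, H. }
split.
- apply (cont_mult (fun x => fst (g x))); assumption.
- apply (cont_mult (fun x => - snd (g x))); [|assumption].
  intros x. apply (continuous_opp (fun x => snd (g x))), B.
Qed.

Lemma CInt_pair g a c : ccont g ->
  CInt g a c = (RInt (fun s => fst (g s)) a c, RInt (fun s => snd (g s)) a c).
Proof.
intros [A B]. apply (is_RInt_unique (V := C_R_CompleteNormedModule)).
apply (is_RInt_fct_extend_pair (U := R_NormedModule) (V := R_NormedModule) g);
 apply (RInt_correct (V := R_CompleteNormedModule)), ex_RInt_cont; assumption.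
Qed.

Lemma CInt_ext g k a c : a <= c -> (forall s, a <= s <= c -> g s = k s) -> CInt g a c = CInt k a c.
Proof.
intros Hac H. apply (RInt_ext (V := C_R_CompleteNormedModule)). intros s Hs. rewrite Rmin_left, Rmax_right in Hs by lra.
apply H; lra.
Qed.

(** Continuity of the extension of [g] from [[0,b]] by its boundary values. *)
Definition ccont_on (b : R) (g : R -> C) : Prop := ccont (fun x => g (clamp b x)).

Lemma CInt_clamp b g x : 0 <= x <= b ->
  CInt g 0 x = CInt (fun s => g (clamp b s)) 0 x.
Proof. intros Hx. apply CInt_ext; [lra|]. intros s Hs. now rewrite clamp_id by lra. Qed.

Lemma CInt_scal b g (c : R) x : 0 <= x <= b -> ccont_on b g ->
  CInt (fun s => c * g s)%C 0 x = (c * CInt g 0 x)%C.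
Proof.
intros Hx Hg.
rewrite (CInt_clamp b g x Hx), (CInt_clamp b (fun s => c * g s)%C x Hx), !CInt_pair;
  [|exact Hg|exact (ccont_mult _ _ (ccont_const c) Hg)].
destruct Hg as [A B].
apply injective_projections; cbn [fst snd Cmult RtoC].
- rewrite <- (RInt_scal_cont c) by exact A.
  rewrite Rmult_0_l, Rminus_0_r. apply RInt_ext_all; intros; simpl; ring.
- rewrite <- (RInt_scal_cont c) by exact B.
  rewrite Rmult_0_l, Rplus_0_r. apply RInt_ext_all; intros; simpl; ring.
Qed.

(** Differentiation by components, which reduces the product and quotient rules of
    complex-valued functions to real ones. *)
Definition is_cderive (g : R -> C) (x : R) (l : C) : Prop :=
  is_derive (fun z => fst (g z)) x (fst l) /\ is_derive (fun z => snd (g z)) x (snd l).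

Lemma is_cderive_eq g x l m : is_cderive g x l -> l = m -> is_cderive g x m.
Proof. intros H <-; exact H. Qed.

Lemma is_derive_Rmult f g x f' g' : is_derive f x f' -> is_derive g x g' ->
  is_derive (fun z => f z * g z) x (f' * g x + f x * g').
Proof.
intros Hf Hg. apply (is_derive_mult (K := R_AbsRing) f g); auto. intros; apply Rmult_comm.
Qed.

Lemma is_derive_Rplus f g x f' g' : is_derive f x f' -> is_derive g x g' ->
  is_derive (fun z => f z + g z) x (f' + g').
Proof. exact (is_derive_plus (K := R_AbsRing) (V := R_NormedModule) f g x f' g'). Qed.

Lemma is_derive_Rminus f g x f' g' : is_derive f x f' -> is_derive g x g' ->
  is_derive (fun z => f z - g z) x (f' - g').
Proof. exact (is_derive_minus (K := R_AbsRing) (V := R_NormedModule) f g x f' g'). Qed.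

Lemma is_cderive_minus g k x g' k' : is_cderive g x g' -> is_cderive k x k' ->
  is_cderive (fun z => g z - k z)%C x (g' - k')%C.
Proof. intros [A B] [A' B']; split; now apply is_derive_Rminus. Qed.

Lemma is_cderive_mult g k x g' k' : is_cderive g x g' -> is_cderive k x k' ->
  is_cderive (fun z => g z * k z)%C x (g' * k x + g x * k')%C.
Proof.
intros [A B] [A' B']; split; simpl.
- eapply is_derive_eq.
  + apply is_derive_Rminus; apply is_derive_Rmult; eassumption.
  + simpl. R_ring.
- eapply is_derive_eq.
  + apply is_derive_Rplus; apply is_derive_Rmult; eassumption.
  + simpl. R_ring.
Qed.

Lemma is_cderive_inv g x g' : is_cderive g x g' -> g x <> 0%C ->
  is_cderive (fun z => / g z)%C x (- g' / (g x * g x))%C.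
Proof.
intros [A B] H. pose proof (Csqr_norm_neq_0 _ H) as N.
assert (N' : fst (g x) * fst (g x) + snd (g x) * snd (g x) <> 0).
{ intros E; apply N; rewrite <- E; ring. }
assert (N2 : (fst (g x) * fst (g x) - snd (g x) * snd (g x)) *
   (fst (g x) * fst (g x) - snd (g x) * snd (g x)) +
   (fst (g x) * snd (g x) + snd (g x) * fst (g x)) *
   (fst (g x) * snd (g x) + snd (g x) * fst (g x)) <> 0).
{ intros E. apply (Rmult_integral_contrapositive_currified _ _ N' N').
  rewrite <- E. ring. }
assert (DN : is_derive (fun z => fst (g z) * (fst (g z) * 1) + snd (g z) * (snd (g z) * 1)) x
   (2 * fst g' * fst (g x) + 2 * snd g' * snd (g x))).
{ apply (is_derive_eq _ _ (2 * fst g' * fst (g x) ^ 1 + 2 * snd g' * snd (g x) ^ 1)); [|ring].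
  apply (is_derive_Rplus (fun z => fst (g z) ^ 2) (fun z => snd (g z) ^ 2)).
  - now apply (is_derive_pow (fun z => fst (g z)) 2).
  - now apply (is_derive_pow (fun z => snd (g z)) 2). }
split; simpl.
- eapply is_derive_eq.
  + apply (is_derive_div (fun z => fst (g z))
      (fun z => fst (g z) * (fst (g z) * 1) + snd (g z) * (snd (g z) * 1))).
    * exact A.
    * exact DN.
    * exact N.
  + as_R_eq. unfold zero; simpl. field. split; assumption.
- eapply is_derive_eq.
  + apply (is_derive_div (fun z => - snd (g z))
      (fun z => fst (g z) * (fst (g z) * 1) + snd (g z) * (snd (g z) * 1))).
    * apply (is_derive_opp (K := R_AbsRing) (V := R_NormedModule) (fun z => snd (g z))). exact B.
    * exact DN.
    * exact N.
  + as_R_eq. unfold zero, opp; simpl. field. split; assumption.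
Qed.

(** Derivatives at the end points are not available from one-sided data; the mean
    value theorem needs only continuity there. *)
Lemma RInt_of_derive_open (g g' : R -> R) x : 0 <= x -> cont g -> cont g' ->
  (forall s, 0 < s < x -> is_derive g s (g' s)) -> RInt g' 0 x = g x - g 0.
Proof.
intros Hx Hg Hg' HD.
set (D := fun s => RInt g' 0 s - g s).
assert (DI : forall s, is_derive (fun s => RInt g' 0 s) s (g' s)).
{ intros s. apply (is_derive_RInt g' _ 0); [|apply Hg'].
  apply filter_forall; intros z. apply (RInt_correct (V := R_CompleteNormedModule)).
  now apply ex_RInt_cont. }
destruct (MVT_gen D 0 x (fun _ => 0)) as [c [_ E]].
- intros s Hs. rewrite Rmin_left, Rmax_right in Hs by lra.
  apply (is_derive_eq D s (g' s - g' s)); [|as_R_eq; ring].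
  apply is_derive_Rminus; auto.
- intros s _. apply continuity_pt_filterlim, (cont_minus (fun s => RInt g' 0 s)); [|exact Hg].
  apply (cont_derive _ g' DI).
- unfold D in E. rewrite RInt_point in E. unfold zero in E; simpl in E. lra.
Qed.

Lemma is_derive_clamp b (g : R -> R) x l : 0 < x < b -> is_derive g x l ->
  is_derive (fun z => g (clamp b z)) x l.
Proof.
intros Hx. apply is_derive_ext_loc.
assert (Hd : 0 < Rmin x (b - x)) by (apply Rmin_pos; lra).
exists (mkposreal _ Hd). intros z Hz.
change (Rabs (z - x) < Rmin x (b - x)) in Hz.
pose proof (Rmin_l x (b - x)). pose proof (Rmin_r x (b - x)).
apply Rabs_lt_between in Hz. rewrite clamp_id; [reflexivity|lra].
Qed.

Lemma CInt_of_cderive b g g' x : 0 <= x <= b -> ccont_on b g -> ccont_on b g' ->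
  (forall s, 0 < s < b -> is_cderive g s (g' s)) -> CInt g' 0 x = (g x - g 0)%C.
Proof.
intros Hx [A B] [A' B'] HD.
rewrite (CInt_clamp b _ x Hx), CInt_pair by (split; assumption).
rewrite (RInt_of_derive_open (fun s => fst (g (clamp b s)))); try lra; auto.
rewrite (RInt_of_derive_open (fun s => snd (g (clamp b s)))); try lra; auto.
- rewrite !clamp_id by lra. reflexivity.
- intros s Hs. rewrite clamp_id by lra.
  apply (is_derive_clamp b (fun s => snd (g s))); [lra|]. apply (HD s); lra.
- intros s Hs. rewrite clamp_id by lra.
  apply (is_derive_clamp b (fun s => fst (g s))); [lra|]. apply (HD s); lra.
Qed.

Lemma is_derive_on_cderive b g g' x : is_derive_on (Icc 0 b) g g' -> 0 < x < b ->
  is_cderive g x (g' x).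
Proof.
intros H Hx.
assert (HD : Icc 0 b x) by (unfold Icc; lra).
destruct (H x HD) as [L M].
assert (F : filterdiff (K := R_AbsRing) (U := R_NormedModule) (V := C_R_NormedModule)
   g (locally x) (fun d => scal d (g' x))).
{ split; [exact L|]. intros y Hy.
  apply (is_domin_le (F := within (Icc 0 b) (locally x))).
  - apply M. intros P HP. specialize (Hy P HP). unfold within.
    revert Hy; apply filter_imp; auto.
  - intros P HP. unfold within in HP.
    assert (Hd : 0 < Rmin x (b - x)) by (apply Rmin_pos; lra).
    assert (N : locally x (Icc 0 b)).
    { exists (mkposreal _ Hd). intros z Hz.
      change (Rabs (z - x) < Rmin x (b - x)) in Hz.
      pose proof (Rmin_l x (b - x)). pose proof (Rmin_r x (b - x)).
      apply Rabs_lt_between in Hz. unfold Icc; lra. }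
    generalize (filter_and _ _ N HP). apply filter_imp. intros z [A B]. now apply B. }
split.
- apply (filterdiff_comp (U := R_NormedModule) (V := C_R_NormedModule) (W := R_NormedModule)
    g (fun z : C => fst z) _ (fun z : C => fst z) F).
  apply filterdiff_linear, (is_linear_fst (U := R_NormedModule) (V := R_NormedModule)).
- apply (filterdiff_comp (U := R_NormedModule) (V := C_R_NormedModule) (W := R_NormedModule)
    g (fun z : C => snd z) _ (fun z : C => snd z) F).
  apply filterdiff_linear, (is_linear_snd (U := R_NormedModule) (V := R_NormedModule)).
Qed.

Lemma ccont_of_continuous (g : R -> C) :
  (forall x, continuous (T := R_UniformSpace) (U := C_UniformSpace) g x) -> ccont g.
Proof.
intros H; split; intros x.
- apply (continuous_comp g (fun z : C => fst z)); [apply H|].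
  apply (continuous_fst (U := R_UniformSpace) (V := R_UniformSpace)).
- apply (continuous_comp g (fun z : C => snd z)); [apply H|].
  apply (continuous_snd (U := R_UniformSpace) (V := R_UniformSpace)).
Qed.

Lemma ccont_on_of_continuous_on b g : 0 < b ->
  continuous_on (T := R_UniformSpace) (U := C_UniformSpace) (Icc 0 b) g -> ccont_on b g.
Proof.
intros Hb Hg. apply ccont_of_continuous; intros x.
apply (continuous_retract (Icc 0 b) g (clamp b)); [exact Hg| |apply cont_clamp].
intros p; now apply clamp_in.
Qed.

Lemma ccont_on_of_derive_on b g g' : 0 < b -> is_derive_on (Icc 0 b) g g' -> ccont_on b g.
Proof.
intros Hb Hg. apply ccont_on_of_continuous_on; [exact Hb|]. intros x Hx.
apply (filterdiff_continuous_aux (K := R_AbsRing) (U := R_NormedModule) (V := C_R_NormedModule)).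
- eexists. apply (Hg x Hx).
- intros P HP. unfold within. revert HP; apply filter_imp; auto.
Qed.

(** * Transmutation of powers *)

Definition moment_velocity h q Q (p p' : R -> R) (x : R) : R :=
  h * p (- x) + moment h q Q p' x + density_moment q Q p x.

(** In the second derivative of a moment the terms with [p'] cancel: they enter with
    opposite signs because the two substitutions run along opposite characteristics. *)
Lemma is_derive_moment_velocity h q Q p p' p'' (x : R) : cont q -> cont2 Q ->
  (forall t, is_derive p t (p' t)) -> (forall t, is_derive p' t (p'' t)) -> cont p'' ->
  is_derive (moment_velocity h q Q p p') x
    (moment h q Q p'' x + q x * p x + source_moment Q p x).
Proof.
intros Hq HQ Hp Hp' Hc.
assert (Cp' : cont p') by (eapply cont_derive, Hp').
eapply is_derive_eq.
- apply is_derive_Rplus; [apply is_derive_Rplus|].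
  + apply is_derive_scal. apply (is_derive_ext (fun z => p (0 - z))).
    * intros; f_equal; R_ring.
    * apply is_derive_reflect; exact Hp.
  + apply is_derive_moment; eassumption.
  + apply is_derive_density_moment; eassumption.
- replace (0 - x) with (- x) by ring. R_ring.
Qed.

Definition dpow (k : nat) (t : R) : R := INR k * t ^ pred k.
Definition ddpow (k : nat) (t : R) : R := INR k * dpow (pred k) t.

Lemma is_derive_power k (t : R) : is_derive (fun t => t ^ k) t (dpow k t).
Proof.
apply (is_derive_eq _ _ (INR k * 1 * t ^ pred k)); [|unfold dpow; ring].
apply (is_derive_pow (fun t => t)). apply (is_derive_id (K := R_AbsRing)).
Qed.

Lemma is_derive_dpow k (t : R) : is_derive (dpow k) t (ddpow k t).
Proof. apply is_derive_scal, is_derive_power. Qed.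

Lemma cont_dpow k : cont (dpow k).
Proof. apply cont_mult; [apply cont_const|apply cont_pow]. Qed.

Lemma cont_ddpow k : cont (ddpow k).
Proof. apply cont_mult; [apply cont_const|apply cont_dpow]. Qed.

Lemma moment_ddpow h q Q k x : cont q -> cont2 Q ->
  moment h q Q (ddpow k) x
  = INR k * INR (pred k) * moment h q Q (fun t => t ^ pred (pred k)) x.
Proof.
intros Hq HQ. unfold moment. rewrite <- RInt_scal_cont.
- apply RInt_ext_all; intros t. unfold ddpow, dpow. ring.
- apply cont_mult; [|apply cont_pow]. apply cont2_slice. now apply cont2_kernel.
Qed.

Section Transmutation.

Variables (b : R) (q f f' : R -> C) (h : C) (K : R -> R -> C).
Hypotheses (hb : 0 < b)
  (hq : continuous_on (T := R_UniformSpace) (U := C_UniformSpace) (Icc 0 b) q)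
  (hK : is_transmutation_kernel b q h K).

Definition ext_potential (x : R) : C := q (clamp b x).

(** The second argument is retracted onto the interval from [- clamp b x] to
    [clamp b x], so that the pair lies in the domain of the kernel. *)
Definition ext_kernel (x t : R) : C :=
  K (clamp b x) (Rmax (- clamp b x) (Rmin (clamp b x) t)).

Definition ext_source (x t : R) : C := (ext_potential x * ext_kernel x t)%C.

Definition re_pot (x : R) : R := fst (ext_potential x).
Definition im_pot (x : R) : R := snd (ext_potential x).
Definition re_src (x t : R) : R := fst (ext_source x t).
Definition im_src (x t : R) : R := snd (ext_source x t).

Lemma ext_potential_id x : 0 <= x <= b -> ext_potential x = q x.
Proof. intros Hx. unfold ext_potential. now rewrite clamp_id. Qed.

Lemma ext_kernel_id x t : kernel_domain b (x, t) -> ext_kernel x t = K x t.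
Proof.
intros [Hx Ht]; simpl in Hx, Ht. unfold ext_kernel. rewrite clamp_id by lra.
apply Rabs_le_between in Ht.
rewrite (Rmin_right x t) by lra. rewrite Rmax_right by lra. reflexivity.
Qed.

Lemma ccont_ext_potential : ccont ext_potential.
Proof. exact (ccont_on_of_continuous_on b q hb hq). Qed.

Lemma cont_re_pot : cont re_pot.
Proof. apply ccont_ext_potential. Qed.

Lemma cont_im_pot : cont im_pot.
Proof. apply ccont_ext_potential. Qed.

Lemma continuous_ext_kernel p :
  continuous (T := prod_UniformSpace R_UniformSpace R_UniformSpace) (U := C_UniformSpace)
   (fun p => ext_kernel (fst p) (snd p)) p.
Proof.
apply (continuous_retract (kernel_domain b) (fun p => K (fst p) (snd p))
  (fun p : R * R => (clamp b (fst p),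
     Rmax (- clamp b (fst p)) (Rmin (clamp b (fst p)) (snd p))))).
- apply hK.
- intros [x1 t1]. pose proof (clamp_in b x1 hb) as H. split; [exact H|]. cbn [fst snd].
  apply Rabs_le_between. split; [apply Rmax_l|].
  apply Rmax_lub; [|apply Rmin_l]. lra.
- assert (Cc : continuous (fun p : R * R => clamp b (fst p)) p).
  { apply (continuous_comp fst (clamp b)); [apply continuous_fst|apply cont_clamp]. }
  apply (continuous_comp_2 (fun p : R * R => clamp b (fst p))
    (fun p : R * R => Rmax (- clamp b (fst p)) (Rmin (clamp b (fst p)) (snd p)))
    (fun x y => (x, y))).
  + exact Cc.
  + apply continuous_Rmax; [apply (continuous_opp (fun p : R * R => clamp b (fst p))); exact Cc|].
    apply continuous_Rmin; [exact Cc|apply continuous_snd].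
  + apply (continuous_ext (fun z => z)); [now intros []|apply continuous_id].
Qed.

Lemma cont2_re_ker : cont2 (fun x t => fst (ext_kernel x t)).
Proof.
intros p. apply (continuous_comp (fun p : R * R => ext_kernel (fst p) (snd p)) (fun z : C => fst z)).
- apply continuous_ext_kernel.
- apply (continuous_fst (U := R_UniformSpace) (V := R_UniformSpace)).
Qed.

Lemma cont2_im_ker : cont2 (fun x t => snd (ext_kernel x t)).
Proof.
intros p. apply (continuous_comp (fun p : R * R => ext_kernel (fst p) (snd p)) (fun z : C => snd z)).
- apply continuous_ext_kernel.
- apply (continuous_snd (U := R_UniformSpace) (V := R_UniformSpace)).
Qed.

Lemma cont2_re_src : cont2 re_src.
Proof.
apply cont2_minus; apply cont2_mult; auto using cont2_re_ker, cont2_im_ker;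
 apply (cont2_comp1 _ (fun x _ => x)); auto using cont2_fst, cont_re_pot, cont_im_pot.
Qed.

Lemma cont2_im_src : cont2 im_src.
Proof.
apply cont2_plus; apply cont2_mult; auto using cont2_re_ker, cont2_im_ker;
 apply (cont2_comp1 _ (fun x _ => x)); auto using cont2_fst, cont_re_pot, cont_im_pot.
Qed.

Definition re_kernel : R -> R -> R := kernel (fst h) re_pot re_src.
Definition im_kernel : R -> R -> R := kernel (snd h) im_pot im_src.

(** All points at which the integral equation evaluates [q] and [K] lie in the
    domain, so the extensions may be used; its two components are then instances of
    [kernel]. *)
Lemma kernel_parts x t : kernel_domain b (x, t) -> K x t = (re_kernel x t, im_kernel x t).
Proof.
intros Hd. rewrite (proj2 hK x t Hd).
destruct Hd as [Hx Ht]; simpl in Hx, Ht. apply Rabs_le_between in Ht.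
set (u := (x + t) / 2). set (v := (x - t) / 2).
assert (Hu : 0 <= u) by (unfold u; lra). assert (Hv : 0 <= v) by (unfold v; lra).
assert (Huv : u + v <= b) by (unfold u, v; lra).
rewrite (CInt_ext q ext_potential 0 u); [|lra|intros; now rewrite ext_potential_id by lra].
rewrite (CInt_ext (fun al => CInt (fun be => q (al + be)%R * K (al + be)%R (al - be)%R)%C 0 v)
  (fun al => (char_int re_src al v, char_int im_src al v)) 0 u); [|lra|].
2:{ intros al Hal; cbv beta.
  rewrite (CInt_ext _ (fun be => ext_source (al + be) (al - be)) 0 v); [|lra|].
  2:{ intros be Hbe. unfold ext_source.
      rewrite ext_potential_id, ext_kernel_id; [reflexivity| |lra].
      split; simpl; [split; lra|]. apply Rabs_le_between; lra. }
  apply CInt_pair. split.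
  - apply (cont2_slice (fun al be => re_src (al + be) (al - be))), cont2_diag, cont2_re_src.
  - apply (cont2_slice (fun al be => im_src (al + be) (al - be))), cont2_diag, cont2_im_src. }
assert (CI : forall Q, cont2 Q -> cont (fun al => char_int Q al v)).
{ intros Q HQ al. apply (continuous_comp2 (char_int Q) (fun al => al) (fun _ => v)).
  - now apply cont2_char_int.
  - apply continuous_id.
  - apply continuous_const. }
rewrite !CInt_pair; [| |apply ccont_ext_potential].
2:{ split; simpl; apply CI; [apply cont2_re_src|apply cont2_im_src]. }
assert (D : forall r Q, cont r -> cont2 Q ->
  RInt (fun al => goursat_density r Q al v) 0 u
  = / 2 * RInt r 0 u + RInt (fun al => char_int Q al v) 0 u).
{ intros r Q Hr HQ. rewrite <- RInt_scal_cont by exact Hr.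
  rewrite <- RInt_plus_cont; [|apply cont_mult; [apply cont_const|exact Hr]|now apply CI].
  apply RInt_ext_all; intros al. unfold goursat_density. field. }
unfold re_kernel, im_kernel, kernel. fold u v.
rewrite (D re_pot re_src cont_re_pot cont2_re_src), (D im_pot im_src cont_im_pot cont2_im_src).
change (fun s => fst (ext_potential s)) with re_pot.
change (fun s => snd (ext_potential s)) with im_pot.
apply injective_projections; cbn [fst snd Cplus Cmult Cdiv Cinv RtoC]; field.
Qed.

(** The image of [t ^ k] under the transmutation operator. *)
Definition transmuted (k : nat) (x : R) : C :=
  (x ^ k + moment (fst h) re_pot re_src (fun t => t ^ k) x,
   moment (snd h) im_pot im_src (fun t => t ^ k) x).

Definition transmuted' (k : nat) (x : R) : C :=
  (dpow k x + moment_velocity (fst h) re_pot re_src (fun t => t ^ k) (dpow k) x,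
   moment_velocity (snd h) im_pot im_src (fun t => t ^ k) (dpow k) x).

Lemma is_cderive_transmuted k x : is_cderive (transmuted k) x (transmuted' k x).
Proof.
split; simpl.
- apply is_derive_Rplus; [apply is_derive_power|].
  apply is_derive_moment; [apply cont_re_pot|apply cont2_re_src| |apply cont_dpow].
  intros; apply is_derive_power.
- apply is_derive_moment; [apply cont_im_pot|apply cont2_im_src| |apply cont_dpow].
  intros; apply is_derive_power.
Qed.

Lemma source_parts p x : cont p -> 0 <= x <= b ->
  source_moment re_src p x
  = fst (q x) * moment (fst h) re_pot re_src p x - snd (q x) * moment (snd h) im_pot im_src p x /\
  source_moment im_src p x
  = fst (q x) * moment (snd h) im_pot im_src p x + snd (q x) * moment (fst h) re_pot re_src p x.
Proof.
intros Hp Hx. unfold source_moment, moment.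
assert (E : forall t, - x < t < x -> ext_source x t = (q x * (re_kernel x t, im_kernel x t))%C).
{ intros t Ht. assert (Hd : kernel_domain b (x, t)).
  { split; simpl; [split; lra|]. apply Rabs_le_between; lra. }
  unfold ext_source. now rewrite ext_potential_id, ext_kernel_id, (kernel_parts x t) by auto. }
assert (Cr : cont (fun t => kernel (fst h) re_pot re_src x t * p t)).
{ apply cont_mult; [|exact Hp]. apply cont2_slice, cont2_kernel; [apply cont_re_pot|apply cont2_re_src]. }
assert (Ci : cont (fun t => kernel (snd h) im_pot im_src x t * p t)).
{ apply cont_mult; [|exact Hp]. apply cont2_slice, cont2_kernel; [apply cont_im_pot|apply cont2_im_src]. }
rewrite <- !RInt_scal_cont by assumption. split.
- rewrite <- RInt_minus_cont by (apply cont_mult; [apply cont_const|assumption]).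
  apply RInt_ext. intros t Ht. rewrite Rmin_left, Rmax_right in Ht by lra.
  fold re_kernel im_kernel. unfold re_src. rewrite (E t Ht). cbn [fst snd Cmult]. R_ring.
- rewrite <- RInt_plus_cont by (apply cont_mult; [apply cont_const|assumption]).
  apply RInt_ext. intros t Ht. rewrite Rmin_left, Rmax_right in Ht by lra.
  fold re_kernel im_kernel. unfold im_src. rewrite (E t Ht). cbn [fst snd Cmult]. R_ring.
Qed.

(** The transmutation property on powers: the source of the kernel is [q] times the
    kernel, so its moment joins [q x * x ^ k] to give [q x * transmuted k x]. *)
Lemma is_cderive_transmuted' k x : 0 <= x <= b ->
  is_cderive (transmuted' k) x
    ((INR k * INR (pred k))%R * transmuted (pred (pred k)) x + q x * transmuted k x)%C.
Proof.
intros Hx. destruct (source_parts (fun t => t ^ k) x (cont_pow k) Hx) as [S1 S2].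
assert (Er : re_pot x = fst (q x)) by (unfold re_pot; now rewrite ext_potential_id).
assert (Ei : im_pot x = snd (q x)) by (unfold im_pot; now rewrite ext_potential_id).
split; simpl.
- eapply is_derive_eq.
  + apply is_derive_Rplus; [apply is_derive_dpow|].
    apply is_derive_moment_velocity;
     [apply cont_re_pot|apply cont2_re_src|apply is_derive_power|apply is_derive_dpow|apply cont_ddpow].
  + rewrite moment_ddpow, S1, Er by (apply cont_re_pot || apply cont2_re_src).
    unfold ddpow, dpow. R_ring.
- eapply is_derive_eq.
  + apply is_derive_moment_velocity;
     [apply cont_im_pot|apply cont2_im_src|apply is_derive_power|apply is_derive_dpow|apply cont_ddpow].
  + rewrite moment_ddpow, S2, Ei by (apply cont_im_pot || apply cont2_im_src).
    R_ring.
Qed.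

Lemma transmuted_at_0 k : transmuted k 0 = RtoC (0 ^ k).
Proof.
unfold transmuted, moment, RtoC. rewrite Ropp_0, !RInt_point. unfold zero; simpl.
now rewrite Rplus_0_r.
Qed.

Lemma transmuted'_at_0 k : transmuted' k 0 = (dpow k 0 + h * RtoC (0 ^ k))%C.
Proof.
unfold transmuted', moment_velocity, moment, density_moment.
rewrite Ropp_0, !RInt_point. unfold zero; simpl.
apply injective_projections; simpl; ring.
Qed.

Lemma ccont_transmuted k : ccont_on b (transmuted k).
Proof.
split.
- apply (cont_comp (clamp b) (fun x => fst (transmuted k x))); [apply cont_clamp|].
  apply (cont_derive _ (fun x => fst (transmuted' k x))). apply is_cderive_transmuted.
- apply (cont_comp (clamp b) (fun x => snd (transmuted k x))); [apply cont_clamp|].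
  apply (cont_derive _ (fun x => snd (transmuted' k x))). apply is_cderive_transmuted.
Qed.

Lemma ccont_transmuted' k : ccont_on b (transmuted' k).
Proof.
assert (A : forall x, 0 <= x <= b -> continuous (fun x => fst (transmuted' k x)) x /\
    continuous (fun x => snd (transmuted' k x)) x).
{ intros x Hx. destruct (is_cderive_transmuted' k x Hx) as [A B].
  split; apply (ex_derive_continuous (K := R_AbsRing) (V := R_NormedModule));
    eexists; eassumption. }
split; intros x; pose proof (A _ (clamp_in b x hb)) as [A1 A2].
- apply (continuous_comp (clamp b) (fun x => fst (transmuted' k x))); [apply cont_clamp|exact A1].
- apply (continuous_comp (clamp b) (fun x => snd (transmuted' k x))); [apply cont_clamp|exact A2].
Qed.

Hypotheses (hf : is_derive_on (Icc 0 b) f f')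
  (hf' : is_derive_on (Icc 0 b) f' (fun x => (q x * f x)%C))
  (hf_nz : forall x, Icc 0 b x -> f x <> 0%C)
  (hf0 : f 0 = 1%C)
  (hh : h = f' 0).

(** The quotient [phi f k / f]. *)
Definition reduced_power (k : nat) : R -> C :=
  if Nat.odd k then formal_power f k else formal_power_tilde f k.

Lemma phi_reduced k x : phi f k x = (f x * reduced_power k x)%C.
Proof. unfold phi, reduced_power. now destruct (Nat.odd k). Qed.

(** Two steps of the recursion of formal powers involve [f ^ 2] first and its inverse
    next, for both parities. *)
Lemma reduced_power_rec m x :
  reduced_power (S (S m)) x
  = (INR (S (S m)) * CInt (fun s =>
      (INR (S m) * CInt (fun r => reduced_power m r * (f r * f r)) 0 s) * / (f s * f s)) 0 x)%C.
Proof.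
assert (sq : forall z : C, (z ^ 2 = z * z)%C) by (intros; simpl; ring).
unfold reduced_power. rewrite Nat.odd_succ_succ.
destruct (Nat.odd m) eqn:E.
- cbn [formal_power]. unfold Cpow_sign.
  rewrite Nat.even_succ_succ, Nat.even_succ, E. unfold Nat.odd in E.
  destruct (Nat.even m); [discriminate|].
  f_equal. apply (RInt_ext (V := C_R_CompleteNormedModule)); intros s _. rewrite sq. f_equal. f_equal.
  apply (RInt_ext (V := C_R_CompleteNormedModule)); intros r _. now rewrite sq.
- cbn [formal_power_tilde]. unfold Cpow_sign.
  rewrite Nat.even_succ, E. unfold Nat.odd in E.
  destruct (Nat.even m); [|discriminate].
  f_equal. apply (RInt_ext (V := C_R_CompleteNormedModule)); intros s _. rewrite sq. f_equal. f_equal.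
  apply (RInt_ext (V := C_R_CompleteNormedModule)); intros r _. now rewrite sq.
Qed.

Definition wronskian (k : nat) (x : R) : C :=
  (f x * transmuted' k x - f' x * transmuted k x)%C.

Lemma ccont_f : ccont_on b f.
Proof. exact (ccont_on_of_derive_on b f f' hb hf). Qed.

Lemma ccont_f' : ccont_on b f'.
Proof. exact (ccont_on_of_derive_on b f' _ hb hf'). Qed.

Lemma f_clamp_nz x : f (clamp b x) <> 0%C.
Proof. apply hf_nz. exact (clamp_in b x hb). Qed.

(** As [f'' = q f], the potential cancels in the derivative of the Wronskian. *)
Lemma wronskian_int k x : 0 <= x <= b ->
  wronskian k x = (wronskian k 0 + (INR k * INR (pred k))%R *
    CInt (fun s => f s * transmuted (pred (pred k)) s) 0 x)%C.
Proof.
intros Hx.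
assert (CC : ccont_on b (fun s => f s * transmuted (pred (pred k)) s)%C).
{ apply (ccont_mult (fun s => f (clamp b s))); [apply ccont_f|apply ccont_transmuted]. }
rewrite <- (CInt_scal b) by assumption.
rewrite (CInt_of_cderive b (wronskian k)).
- ring.
- exact Hx.
- apply (ccont_minus (fun s => f (clamp b s) * transmuted' k (clamp b s))%C
    (fun s => f' (clamp b s) * transmuted k (clamp b s))%C).
  + apply (ccont_mult (fun s => f (clamp b s))); [apply ccont_f|apply ccont_transmuted'].
  + apply (ccont_mult (fun s => f' (clamp b s))); [apply ccont_f'|apply ccont_transmuted].
- exact (ccont_mult _ _ (ccont_const _) CC).
- intros s Hs. eapply is_cderive_eq.
  + apply is_cderive_minus; apply is_cderive_mult.
    * exact (is_derive_on_cderive b f f' s hf Hs).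
    * apply is_cderive_transmuted'; lra.
    * exact (is_derive_on_cderive b f' _ s hf' Hs).
    * apply is_cderive_transmuted.
  + ring.
Qed.

Lemma transmuted_int k x : 0 <= x <= b ->
  transmuted k x = (f x * (RtoC (0 ^ k) + CInt (fun s => wronskian k s * / (f s * f s)) 0 x))%C.
Proof.
intros Hx.
rewrite (CInt_of_cderive b (fun s => transmuted k s * / f s)%C); auto.
- rewrite transmuted_at_0, hf0. field. apply hf_nz; exact Hx.
- apply (ccont_mult (fun s => transmuted k (clamp b s))); [apply ccont_transmuted|].
  apply (ccont_inv (fun s => f (clamp b s))); [apply ccont_f|apply f_clamp_nz].
- apply (ccont_mult (fun s => wronskian k (clamp b s))).
  + apply (ccont_minus (fun s => f (clamp b s) * transmuted' k (clamp b s))%C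
    (fun s => f' (clamp b s) * transmuted k (clamp b s))%C).
    * apply (ccont_mult (fun s => f (clamp b s))); [apply ccont_f|apply ccont_transmuted'].
    * apply (ccont_mult (fun s => f' (clamp b s))); [apply ccont_f'|apply ccont_transmuted].
  + apply (ccont_inv (fun s => f (clamp b s) * f (clamp b s))%C).
    * apply (ccont_mult (fun s => f (clamp b s))); apply ccont_f.
    * intros s. apply Cmult_neq_0; apply f_clamp_nz.
- intros s Hs. assert (Hnz : f s <> 0%C) by (apply hf_nz; unfold Icc; lra).
  eapply is_cderive_eq.
  + apply is_cderive_mult; [apply is_cderive_transmuted|apply is_cderive_inv; [|exact Hnz]].
    exact (is_derive_on_cderive b f f' s hf Hs).
  + unfold wronskian. field. exact Hnz.
Qed.

(** The two integrations of [wronskian_int] and [transmuted_int] build [transmuted k]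
    from [transmuted (k - 2)] as [reduced_power_rec] builds the formal powers. The
    initial values agree because the moments vanish at [0] and [h = f' 0]. *)
Lemma transmuted_phi k x : 0 <= x <= b -> transmuted k x = phi f k x.
Proof.
revert x; induction k as [k IH] using lt_wf_ind; intros x Hx.
rewrite phi_reduced, (transmuted_int k x Hx). f_equal.
assert (W0 : wronskian k 0 = RtoC (dpow k 0)).
{ unfold wronskian. rewrite transmuted_at_0, transmuted'_at_0, hf0, <- hh. ring. }
destruct k as [|[|m]].
- rewrite (CInt_ext _ (fun _ => RtoC 0) 0 x); [|lra|].
  + rewrite CInt_pair by apply ccont_const. simpl. rewrite !RInt_const. simpl.
    unfold scal, reduced_power; simpl; unfold mult; simpl.
    apply injective_projections; simpl; ring.
  + intros s Hs. rewrite wronskian_int, W0 by lra. unfold dpow; simpl.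
    rewrite !Rmult_0_l. ring.
- change (reduced_power 1) with (formal_power f 1). cbn [formal_power].
  simpl pow. rewrite Rmult_0_l, Cplus_0_l. change (INR 1) with 1. rewrite Cmult_1_l.
  apply CInt_ext; [lra|]. intros s Hs. rewrite wronskian_int, W0 by lra.
  unfold dpow, Cpow_sign; simpl. rewrite Rmult_0_r, !Rmult_1_r.
  replace (f s * (f s * 1))%C with (f s * f s)%C by ring. ring.
- rewrite reduced_power_rec.
  replace (0 ^ S (S m)) with 0 by (simpl; ring). rewrite Cplus_0_l.
  assert (CC : ccont_on b (fun s => f s * transmuted m s)%C).
  { apply (ccont_mult (fun s => f (clamp b s))); [apply ccont_f|apply ccont_transmuted]. }
  assert (EW : forall s, 0 <= s <= x -> wronskian (S (S m)) s =
    (INR (S (S m)) * (INR (S m) * CInt (fun r => reduced_power m r * (f r * f r)) 0 s))%C).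
  { intros s Hs. rewrite wronskian_int, W0 by lra.
    replace (dpow (S (S m)) 0) with 0 by (unfold dpow; simpl; ring).
    cbn [pred]. rewrite RtoC_mult.
    rewrite (CInt_ext (fun s => f s * transmuted m s)%C (fun r => reduced_power m r * (f r * f r))%C);
      [ring|lra|].
    intros r Hr. rewrite (IH m) by (lia || lra).
    rewrite phi_reduced. ring. }
  assert (CW : ccont_on b (fun s => / INR (S (S m)) * (wronskian (S (S m)) s * / (f s * f s)))%C).
  { apply (ccont_mult (fun _ => / INR (S (S m)))%C); [apply ccont_const|].
    apply (ccont_mult (fun s => wronskian (S (S m)) (clamp b s))).
    - apply (ccont_minus (fun s => f (clamp b s) * transmuted' (S (S m)) (clamp b s))%C
      (fun s => f' (clamp b s) * transmuted (S (S m)) (clamp b s))%C).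
      + apply (ccont_mult (fun s => f (clamp b s))); [apply ccont_f|apply ccont_transmuted'].
      + apply (ccont_mult (fun s => f' (clamp b s))); [apply ccont_f'|apply ccont_transmuted].
    - apply (ccont_inv (fun s => f (clamp b s) * f (clamp b s))%C).
      + apply (ccont_mult (fun s => f (clamp b s))); apply ccont_f.
      + intros s. apply Cmult_neq_0; apply f_clamp_nz. }
  assert (NZ : RtoC (INR (S (S m))) <> 0%C).
  { intros E. apply RtoC_inj in E. revert E. apply not_0_INR. lia. }
  rewrite (CInt_ext (fun s => INR (S m) * CInt (fun r => reduced_power m r * (f r * f r)) 0 s * / (f s * f s))%C
    (fun s => / INR (S (S m)) * (wronskian (S (S m)) s * / (f s * f s)))%C); [|lra|].
  2:{ intros s Hs. rewrite (EW s Hs). field. split; [|exact NZ].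
      apply hf_nz; unfold Icc; lra. }
  rewrite <- (CInt_scal b) by assumption.
  apply CInt_ext; [lra|]. intros s Hs. field. split; [apply hf_nz; unfold Icc; lra|exact NZ].
Qed.

End Transmutation.

(** * The recursive coefficients *)

Lemma legendre_moment_inner j k : legendre_moment j k = inner (legendre j) (fun y => y ^ k).
Proof. reflexivity. Qed.

Lemma inner_pow_expand g k : cont g ->
  inner g (fun y => y ^ k) = sum_n (fun j => legendre_moment j k * legendre_coef g j) k.
Proof.
intros Hg. rewrite inner_sym.
rewrite (inner_ext _ (legendre_sum (fun y => y ^ k) k)).
2:{ intros y _. symmetry. apply (legendre_sum_span k); [apply in_span_pow|lia]. }
unfold legendre_sum. rewrite inner_comb by exact Hg.
apply sum_n_ext; intros j. unfold legendre_coef.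
rewrite legendre_moment_inner, (inner_sym (fun y => y ^ k)), (inner_sym g). R_ring.
Qed.

Lemma inner_span_above n u j : in_span n u -> (n < j)%nat -> inner u (legendre j) = 0.
Proof.
intros [c Hc] Hj. rewrite (inner_ext u _ _ (fun y _ => Hc y)).
rewrite inner_comb by apply cont_legendre.
apply sum_n_zero; intros i Hi. rewrite legendre_orth by lia. ring.
Qed.

Lemma legendre_moment_parity j k : Nat.even j <> Nat.even k -> legendre_moment j k = 0.
Proof.
intros H.
set (F := fun y => legendre j y * y ^ k).
assert (HF : cont F) by (apply cont_mult; [apply cont_legendre|apply cont_pow]).
assert (E : forall y, F (- y) = - F y).
{ intros y. unfold F. rewrite legendre_parity.
  replace (- y) with (-1 * y) by ring. rewrite Rpow_mult_distr.
  replace ((-1) ^ j * legendre j y * ((-1) ^ k * y ^ k))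
    with ((-1) ^ j * (-1) ^ k * (legendre j y * y ^ k)) by ring.
  assert (P : forall n, (-1) ^ n = if Nat.even n then 1 else -1).
  { induction n as [|n IH]; [reflexivity|]. rewrite Nat.even_succ, <- Nat.negb_even.
    simpl. rewrite IH. destruct (Nat.even n); simpl; ring. }
  rewrite !P. destruct (Nat.even j), (Nat.even k); try congruence; ring. }
change (RInt F (-1) 1 = 0).
pose proof (RInt_comp_lin F (-1) 0 (-1) 1) as S.
replace (-1 * -1 + 0) with 1 in S by ring. replace (-1 * 1 + 0) with (-1) in S by ring.
specialize (S (ex_RInt_cont F _ _ HF)).
rewrite (RInt_ext_all _ F) in S.
- assert (T : RInt F 1 (-1) = - RInt F (-1) 1).
  { symmetry. apply (opp_RInt_swap F (-1) 1). now apply ex_RInt_cont. }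
  rewrite T in S. lra.
- intros y. unfold scal; simpl; unfold mult; simpl.
  replace (-1 * y + 0) with (- y) by ring. rewrite E. ring.
Qed.

(** The norm of [legendre k] paired with its leading term: multiplication by [y]
    relates the value at [k + 1] to that at [k], as [y ^ k] is orthogonal to
    [legendre (k + 2)]. *)
Lemma legendre_moment_diag k : legendre_moment k k <> 0.
Proof.
apply Rgt_not_eq. induction k as [|k IH].
- rewrite legendre_moment_inner, (inner_sym _ (fun y => y ^ 0)).
  rewrite (inner_ext _ (legendre 0)) by reflexivity.
  rewrite legendre_norm. simpl. apply Rdiv_lt_0_compat; lra.
- rewrite legendre_moment_inner, inner_sym.
  assert (H := inner_mul_legendre (S k) (fun y => y ^ k) (cont_pow k)).
  rewrite (inner_span_above k (fun y => y ^ k) (S (S k)) (in_span_pow k)) in H by lia.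
  change (fun y => y ^ S k) with (fun y => y * y ^ k). rewrite H. cbn [pred].
  rewrite inner_sym, <- legendre_moment_inner, Rmult_0_r, Rplus_0_l.
  apply Rmult_gt_0_compat; [|exact IH].
  rewrite S_INR. pose proof (pos_INR k). apply Rdiv_lt_0_compat; lra.
Qed.

Lemma legendre_coef_rec g k : cont g -> (2 <= k)%nat ->
  legendre_coef g k
  = / legendre_moment k k * (inner g (fun y => y ^ k)
    - sum_n (fun j => if Bool.eqb (Nat.even j) (Nat.even k)
                      then legendre_moment j k * legendre_coef g j else 0) (k - 2)).
Proof.
intros Hg Hk. destruct k as [|[|m]]; try lia.
replace (S (S m) - 2)%nat with m by lia.
rewrite inner_pow_expand, !sum_n_S by exact Hg.
rewrite (legendre_moment_parity (S m) (S (S m))).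
- rewrite (sum_n_ext (fun j => legendre_moment j (S (S m)) * legendre_coef g j)
    (fun j => if Bool.eqb (Nat.even j) (Nat.even (S (S m)))
      then legendre_moment j (S (S m)) * legendre_coef g j else 0)).
  + apply Rminus_diag_uniq. field. apply legendre_moment_diag.
  + intros j. destruct (Bool.eqb _ _) eqn:E; [reflexivity|].
    rewrite legendre_moment_parity; [as_R_eq; ring|].
    intros H; rewrite H, Bool.eqb_reflx in E; discriminate.
- rewrite (Nat.even_succ (S m)), <- Nat.negb_even. destruct (Nat.even (S m)); discriminate.
Qed.

Lemma fst_sum_n (F : nat -> C) n : fst (sum_n F n) = sum_n (fun j => fst (F j)) n.
Proof.
induction n as [|n IH]; [now rewrite !sum_O|].
rewrite sum_n_S, <- IH, sum_Sn. reflexivity.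
Qed.

Lemma snd_sum_n (F : nat -> C) n : snd (sum_n F n) = sum_n (fun j => snd (F j)) n.
Proof.
induction n as [|n IH]; [now rewrite !sum_O|].
rewrite sum_n_S, <- IH, sum_Sn. reflexivity.
Qed.

Lemma moment_rescale h q Q k x : cont q -> cont2 Q ->
  moment h q Q (fun t => t ^ k) x
  = x ^ S k * inner (fun y => kernel h q Q x (x * y)) (fun y => y ^ k).
Proof.
intros Hq HQ. unfold moment, inner.
assert (CK : cont (kernel h q Q x)) by now apply cont2_slice, cont2_kernel.
assert (CF : cont (fun t => kernel h q Q x t * t ^ k)) by (apply cont_mult; [exact CK|apply cont_pow]).
pose proof (RInt_comp_lin (fun t => kernel h q Q x t * t ^ k) x 0 (-1) 1) as S.
replace (x * -1 + 0) with (- x) in S by ring. replace (x * 1 + 0) with x in S by ring.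
rewrite <- S by now apply ex_RInt_cont.
rewrite <- RInt_scal_cont.
- apply RInt_ext_all; intros y. unfold scal; simpl; unfold mult; simpl.
  rewrite Rplus_0_r, Rpow_mult_distr. ring.
- apply cont_mult; [|apply cont_pow]. apply (cont_comp (fun y => x * y)); [|exact CK].
  apply cont_mult; [apply cont_const|apply cont_id].
Qed.

(** Both families solve the same triangular system, whose diagonal entries
    [legendre_moment k k] do not vanish. *)
Lemma beta_legendre_coef f x (g : R -> C) : 0 < x -> ccont g ->
  (forall k, phi f k x = (x ^ k + x ^ S k * inner (fun y => fst (g y)) (fun y => y ^ k),
                          x ^ S k * inner (fun y => snd (g y)) (fun y => y ^ k))) ->
  forall k, beta f k x = (x * legendre_coef (fun y => fst (g y)) k,
                          x * legendre_coef (fun y => snd (g y)) k).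
Proof.
intros Hx [Cr Ci] Hphi.
set (gr := fun y => fst (g y)) in *. set (gi := fun y => snd (g y)) in *.
assert (N : forall k, x ^ k <> 0) by (intros; apply pow_nonzero; lra).
assert (E : forall k, (phi f k x / RtoC x ^ k - 1)%C
   = (x * inner gr (fun y => y ^ k), x * inner gi (fun y => y ^ k))).
{ intros k. rewrite Hphi, <- RtoC_pow.
  specialize (N k). unfold Cdiv. rewrite <- RtoC_inv by exact N.
  apply injective_projections; cbn [fst snd Cplus Cminus Copp Cmult RtoC pow]; field; exact N. }
induction k as [k IH] using lt_wf_ind.
destruct (Nat.lt_ge_cases k 2) as [Hk|Hk].
- destruct k as [|[|k]]; [| |lia].
  + rewrite beta_0. specialize (E 0%nat).
    replace (phi f 0 x / RtoC x ^ 0)%C with (f x) in E.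
    2:{ unfold phi; simpl. field. }
    change (fun y : R => y ^ 0) with (legendre 0) in E.
    rewrite E. unfold legendre_coef.
    apply injective_projections; cbn [fst snd Cdiv Cinv Cmult RtoC]; simpl INR; field.
  + rewrite beta_1. specialize (E 1%nat).
    replace (RtoC x ^ 1)%C with (RtoC x) in E by (simpl; ring).
    assert (P : forall u, inner u (fun y => y ^ 1) = inner u (legendre 1)).
    { intros u. apply RInt_ext_all; intros; simpl; ring. }
    rewrite !P in E. rewrite E. unfold legendre_coef.
    apply injective_projections; cbn [fst snd Cdiv Cinv Cmult RtoC]; simpl INR; field.
- rewrite beta_rec by exact Hk. rewrite E.
  pose proof (legendre_moment_diag k) as D.
  rewrite (legendre_coef_rec gr k Cr Hk), (legendre_coef_rec gi k Ci Hk).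
  match goal with |- context [sum_n ?F (k - 2)] => set (F0 := F) end.
  assert (Sr : fst (sum_n F0 (k - 2)) = x * sum_n (fun j => if Bool.eqb (Nat.even j) (Nat.even k)
                      then legendre_moment j k * legendre_coef gr j else 0) (k - 2)).
  { rewrite fst_sum_n, <- sum_n_scal. apply sum_n_ext_loc; intros j Hj. unfold F0.
    destruct (Bool.eqb _ _); [|as_R_eq; simpl; ring].
    rewrite IH by lia. simpl. R_ring. }
  assert (Si : snd (sum_n F0 (k - 2)) = x * sum_n (fun j => if Bool.eqb (Nat.even j) (Nat.even k)
                      then legendre_moment j k * legendre_coef gi j else 0) (k - 2)).
  { rewrite snd_sum_n, <- sum_n_scal. apply sum_n_ext_loc; intros j Hj. unfold F0.
    destruct (Bool.eqb _ _); [|as_R_eq; simpl; ring].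
    rewrite IH by lia. simpl. R_ring. }
  rewrite <- RtoC_inv by exact D.
  apply injective_projections; cbn [fst snd Cplus Cminus Copp Cmult RtoC].
  + rewrite Sr. R_ring.
  + rewrite Si. R_ring.
Qed.

(** * The series of the kernel *)

Lemma Cmod_le_parts (z : C) : Cmod z <= Rabs (fst z) + Rabs (snd z).
Proof.
unfold Cmod. pose proof (Rabs_pos (fst z)). pose proof (Rabs_pos (snd z)).
rewrite <- (sqrt_Rsqr (Rabs (fst z) + Rabs (snd z))) by lra.
apply sqrt_le_1_alt. rewrite <- (pow2_abs (fst z)), <- (pow2_abs (snd z)). unfold Rsqr. nra.
Qed.

Theorem theorem3p2 (b : R) (q f f' : R -> C) (h : C) (K : R -> R -> C)
  (hb : 0 < b)
  (hq : continuous_on (T := R_UniformSpace) (U := C_UniformSpace) (Icc 0 b) q)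
  (hf : is_derive_on (Icc 0 b) f f')
  (hf' : is_derive_on (Icc 0 b) f' (fun x => (q x * f x)%C))
  (hf_nz : forall x, Icc 0 b x -> f x <> 0%C)
  (hf0 : f 0 = 1%C)
  (hh : h = f' 0)
  (hK : is_transmutation_kernel b q h K) :
  forall x : R, 0 < x <= b ->
    forall eps : R, 0 < eps ->
      exists N : nat, forall n : nat, (N <= n)%nat ->
        forall t : R, - x <= t <= x ->
          Cmod (K x t - sum_n (fun j => beta f j x / x * legendre j (t / x)) n)%C
            < eps.
Proof.
intros x Hx eps He.
set (kr := re_kernel b q h K). set (ki := im_kernel b q h K).
set (g := fun y => (kr x (x * y), ki x (x * y))).
assert (Hqr := cont_re_pot b q hb hq). assert (Hqi := cont_im_pot b q hb hq).
assert (HQr := cont2_re_src b q h K hb hq hK). assert (HQi := cont2_im_src b q h K hb hq hK).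
assert (Dg : forall h0 q0 Q0, cont q0 -> cont2 Q0 ->
  (forall y, is_derive (fun y => kernel h0 q0 Q0 x (x * y)) y (x * kernel_dt q0 Q0 x (x * y)))
  /\ cont (fun y => x * kernel_dt q0 Q0 x (x * y))).
{ intros h0 q0 Q0 H0 H1. split.
  - intros y. eapply is_derive_eq.
    + apply (is_derive_comp (kernel h0 q0 Q0 x) (fun y => x * y)).
      * now apply is_derive_kernel.
      * apply is_derive_scal, (is_derive_id (K := R_AbsRing)).
    + unfold scal, one; simpl; unfold mult; simpl. R_ring.
  - apply cont_mult; [apply cont_const|].
    apply (cont_comp (fun y => x * y)); [apply cont_mult; [apply cont_const|apply cont_id]|].
    now apply cont_kernel_dt. }
destruct (Dg (fst h) _ _ Hqr HQr) as [Dr Cr'].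
destruct (Dg (snd h) _ _ Hqi HQi) as [Di Ci'].
assert (Cg : ccont g).
{ split; [exact (cont_derive _ _ Dr)|exact (cont_derive _ _ Di)]. }
assert (B : forall k, beta f k x = (x * legendre_coef (fun y => fst (g y)) k,
                          x * legendre_coef (fun y => snd (g y)) k)).
{ apply beta_legendre_coef; [lra|exact Cg|]. intros k.
  rewrite <- (transmuted_phi b q f f' h K hb hq hK hf hf' hf_nz hf0 hh) by lra.
  unfold transmuted. now rewrite !moment_rescale. }
assert (He2 : 0 < eps / 2) by lra.
destruct (legendre_series_uniform _ _ Dr Cr' _ He2) as [N1 H1].
destruct (legendre_series_uniform _ _ Di Ci' _ He2) as [N2 H2].
exists (Nat.max N1 N2). intros n Hn t Ht.
set (y := t / x).
assert (Hy : -1 <= y <= 1).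
{ unfold y. split; apply (Rmult_le_reg_r x); try lra;
   unfold Rdiv; rewrite Rmult_assoc, Rinv_l; lra. }
assert (Et : x * y = t) by (unfold y; field; lra).
specialize (H1 n ltac:(lia) y Hy). specialize (H2 n ltac:(lia) y Hy).
assert (Hd : kernel_domain b (x, t)).
{ split; simpl; [split; lra|]. apply Rabs_le_between; lra. }
rewrite (kernel_parts b q h K hb hq hK x t Hd).
eapply Rle_lt_trans; [apply Cmod_le_parts|].
assert (F : forall j, (beta f j x / x * legendre j y)%C
   = (legendre_coef (fun y => fst (g y)) j * legendre j y,
      legendre_coef (fun y => snd (g y)) j * legendre j y)).
{ intros j. rewrite B. unfold Cdiv. rewrite <- RtoC_inv by lra.
  apply injective_projections; cbn [fst snd Cmult RtoC]; field; lra. }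
rewrite (sum_n_ext _ _ n F).
match goal with |- Rabs (fst (?a - ?s)%C) + _ < _ =>
  change (Rabs (fst a - fst s) + Rabs (snd a - snd s) < eps) end.
rewrite fst_sum_n, snd_sum_n. cbn [fst snd].
rewrite Et in H1, H2. fold kr ki in H1, H2 |- *.
replace eps with (eps / 2 + eps / 2) by field.
apply Rplus_lt_compat; [exact H1|exact H2].
Qed.
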